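(* Let $k$ be a real number with $0<k^2<1$. If the series below converges, then $$\sum_{n=0}^{\infty} (-1)^{\lfloor n/2\rfloor}(2n+1)\,\operatorname{sech}^2\!\left(\frac{2n+1}{2}\,\frac{K'}{K}\,\pi\right) = \frac{K^2\sqrt{k'}\,\Bigl(\bigl(k(\sqrt{1-k}-\sqrt{1+k})+2(\sqrt{1-k}+\sqrt{1+k})\bigr)K-2\bigl(\sqrt{1-k}+\sqrt{1+k}\bigr)E\Bigr)}{\pi^2\bigl(K'(E-K)+E'K\bigr)}.$$
   Context: For the elliptic modulus $k$ (with $0<k^2<1$), write $k'=\sqrt{1-k^2}$. The complete elliptic integrals of the first and second kind are $K=K(k)=\int_0^{\pi/2}\frac{d\theta}{\sqrt{1-k^2\sin^2\theta}}$ and $E=E(k)=\int_0^{\pi/2}\sqrt{1-k^2\sin^2\theta}\,d\theta$; also $K'=K(k')$ and $E'=E(k')$. Here $\operatorname{sech} x = 1/\cosh x$. *)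

(* Defs.v *)
(* Stdlib reals with Coquelicot. *)
From Stdlib Require Import Reals.
From Coquelicot Require Import Coquelicot.
Open Scope R_scope.

(* All elliptic functions below take the modulus k, not the parameter m = k^2. *)

Definition ellipticK (k : R) : R :=
  RInt (fun t : R => 1 / sqrt (1 - k ^ 2 * sin t ^ 2)) 0 (PI / 2).

Definition ellipticE (k : R) : R :=
  RInt (fun t : R => sqrt (1 - k ^ 2 * sin t ^ 2)) 0 (PI / 2).

Definition compl_modulus (k : R) : R := sqrt (1 - k ^ 2).

Definition sech (x : R) : R := 1 / cosh x.

(* The floor of n/2 is Euclidean division on nat. *)
Definition sech2_term (k : R) (n : nat) : R :=
  (-1) ^ Nat.div n 2 * (2 * INR n + 1)
  * sech ((2 * INR n + 1) / 2
          * (ellipticK (compl_modulus k) / ellipticK k) * PI) ^ 2.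

(* Main.v *)
Require Import Defs.
From Stdlib Require Import Reals.
From Coquelicot Require Import Coquelicot.
From Stdlib Require Import Lra Lia Psatz ZArith.
Open Scope R_scope.

(** Put [h = PI * K' / K] and [m = 2 * n + 1].  The series is termwise twice the
    derivative in [h] of the Lambert series
    [T(h) = 1 - 2 * sum_n (-1)^(n/2) / (exp (m * h) + 1)], so everything reduces to a
    closed form for [T] in terms of [k] and [K], which is then differentiated in [k].

    Expanding each term of [T] geometrically and exchanging the sums turns [T(h)] into
    the bilateral sum [sumV (2 * h)], one of four sums over the integers
    ([sumA], [sumB], [sumU], [sumV]) that are the values of one function
    [D(x) = sum_j x^j * sech (j * h)] at [x = 1], [-1], [exp (- h / 2)] and
    [- exp (- h / 2)]; up to the factor [2 * K / PI] they are values of the Jacobi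
    function dn.  Products of such sums are convolutions, and the coefficients
    [sum_j sech (j * h) * sech ((n - j) * h)], with or without a sign [(-1)^j],
    telescope, because [sinh (n * h) * sech (j * h) * sech ((n - j) * h)] is the
    difference of [tanh (j * h)] and [tanh ((j - n) * h)]
    ([convolution_sech], [convolution_sgn_sech]).
    This yields [A(2h) = (A + B) / 2] and [B(2h)^2 = A * B], an arithmetic-geometric mean
    iteration, together with [U * V = A * B] and [U^2 + V^2 = 2 * A^2], from which
    [T(h)^2 = V(2h)^2 = B * (A + B) / 2] ([sumV_double]).

    Gauss's transformation says that [gauss_I a b], the integral of
    [1 / sqrt (a^2 cos^2 + b^2 sin^2)], is unchanged by one step of the mean iteration.
    Along [h], [2h], [4h], ... both [A] and [B] tend to [1], hence
    [gauss_I A B = PI / 2].  With [C = sqrt (A^2 - B^2)] the same transformation read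
    backwards doubles [gauss_I A C], and the logarithmic size of [gauss_I A C] as [C] tends
    to [0] gives [gauss_I A C = h / 2].  So the modulus [C / A] has [K = A * PI / 2] and
    [K' = A * h / 2], that is [PI * K' / K = h]; since [PI * K' / K] is injective in the
    modulus, [A = 2 * K / PI] and [B = k' * A] ([sums_elliptic]).  Therefore
    [T = (K / PI) * sqrt k' * (sqrt (1 + k) + sqrt (1 - k))] ([sumV_elliptic]).

    Both sides are differentiated in [k] by [dK/dk = (E - k'^2 K) / (k k'^2)].
    The denominator [K' (E - K) + E' K] of the theorem is what the derivative of
    [PI * K' / K] produces; it is nonzero because [E > k'^2 K] and [E' > k^2 K']. *)

(** * Series of real numbers *)

(** Lets limit lemmas on sequences of reals apply to the filter form of [is_series]. *)
Lemma is_series_lim (a : nat -> R) (l : R) :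
  is_lim_seq (sum_n a) l -> is_series a l.
Proof. intros H. exact H. Qed.

Lemma Series_nonneg (a : nat -> R) :
  (forall n, 0 <= a n) -> ex_series a -> 0 <= Series a.
Proof.
  intros Ha He.
  rewrite <- (Rmult_0_l (Series a)), <- Series_scal_l.
  apply Series_le; auto.
  intros n; specialize (Ha n); lra.
Qed.

Lemma Series_bound (a b : nat -> R) :
  (forall n, Rabs (a n) <= b n) -> ex_series b -> Rabs (Series a) <= Series b.
Proof.
  intros Hab Hb.
  assert (He : ex_series (fun n => Rabs (a n))).
  { apply (ex_series_le (K := R_AbsRing) (V := R_CompleteNormedModule) _ b); auto.
    intros n. change (Rabs (Rabs (a n)) <= b n). now rewrite Rabs_Rabsolu. }
  eapply Rle_trans; [now apply Series_Rabs|].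
  apply Series_le; auto.
  intros n; split; [apply Rabs_pos | apply Hab].
Qed.

Lemma ex_series_bound (a b : nat -> R) :
  (forall n, Rabs (a n) <= b n) -> ex_series b -> ex_series a.
Proof.
  intros Hab Hb.
  now apply (ex_series_le (K := R_AbsRing) (V := R_CompleteNormedModule) _ b).
Qed.

Lemma ex_series_add (a b : nat -> R) :
  ex_series a -> ex_series b -> ex_series (fun n => a n + b n).
Proof. exact (ex_series_plus (K := R_AbsRing) (V := R_NormedModule) a b). Qed.

Lemma ex_series_geom_scal (C s : R) :
  0 <= s < 1 -> ex_series (fun n => C * s ^ n).
Proof.
  intros Hs. apply (ex_series_scal_l (K := R_AbsRing) C (fun n => s ^ n)).
  exists (/ (1 - s)). apply is_series_geom. rewrite Rabs_pos_eq; lra.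
Qed.

Lemma Series_tail_lim (u : nat -> R) :
  ex_series u -> is_lim_seq (fun N => Series (fun i => u (S N + i)%nat)) 0.
Proof.
  intros Hu.
  apply is_lim_seq_ext with (u := fun N => Series u - sum_n u N).
  - intros N. rewrite (Series_incr_n u (S N)); [|lia|assumption].
    simpl pred. rewrite <- sum_n_Reals. ring.
  - replace (Finite 0) with (Finite (Series u - Series u)) by (f_equal; ring).
    apply is_lim_seq_minus'; [apply is_lim_seq_const|].
    exact (Series_correct u Hu).
Qed.

Lemma ex_series_tail (u : nat -> R) (N : nat) :
  ex_series u -> ex_series (fun i => u (N + i)%nat).
Proof. intros Hu. now apply (ex_series_incr_n u N). Qed.

(** Fubini under a product bound: the error after [N] rows is at most the tail of [u]
    after [N] times the sum of [v]. *)
Lemma is_series_swap (F : nat -> nat -> R) (u v : nat -> R) :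
  (forall n, 0 <= u n) -> (forall n, 0 <= v n) ->
  (forall i j, Rabs (F i j) <= u i * v j) -> ex_series u -> ex_series v ->
  is_series (fun i => Series (F i)) (Series (fun j => Series (fun i => F i j))).
Proof.
  intros Hu0 Hv0 HF Hu Hv.
  assert (Hrow : forall i, ex_series (F i)).
  { intros i. apply ex_series_bound with (b := fun j => u i * v j); auto.
    apply (ex_series_scal_l (K := R_AbsRing) (u i) v Hv). }
  assert (Hcol : forall N j, ex_series (fun i => F (N + i)%nat j)).
  { intros N j. apply ex_series_bound with (b := fun i => u (N + i)%nat * v j); auto.
    apply (ex_series_scal_r (v j) _ (ex_series_tail u N Hu)). }
  assert (Hpart : forall N, ex_series (fun j => sum_n (fun i => F i j) N) /\
     sum_n (fun i => Series (F i)) N = Series (fun j => sum_n (fun i => F i j) N)).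
  { induction N as [|N [IHe IH]].
    - split.
      + apply ex_series_ext with (F 0%nat); [|apply Hrow].
        intros j. now rewrite sum_O.
      + rewrite sum_O. apply Series_ext. intros j. now rewrite sum_O.
    - split.
      + apply ex_series_ext with (fun j => plus (sum_n (fun i => F i j) N) (F (S N) j)).
        * intros j. now rewrite sum_Sn.
        * apply ex_series_add; auto.
      + rewrite sum_Sn, IH. change plus with Rplus.
        rewrite <- Series_plus; auto.
        apply Series_ext. intros j. now rewrite sum_Sn. }
  assert (Htail : forall N, Rabs (Series (fun j => Series (fun i => F i j))
      - sum_n (fun i => Series (F i)) N)
      <= Series (fun i => u (S N + i)%nat) * Series v).
  { intros N. destruct (Hpart N) as [He ->].
    set (t := Series (fun i => u (S N + i)%nat)).
    assert (Hb : forall j, Rabs (Series (fun i => F i j) - sum_n (fun i => F i j) N)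
                 <= t * v j).
    { intros j. rewrite (Series_incr_n (fun i => F i j) (S N)); [|lia|exact (Hcol 0%nat j)].
      simpl pred. rewrite <- sum_n_Reals.
      replace (_ - _) with (Series (fun k => F (S N + k)%nat j)) by ring.
      unfold t. rewrite <- Series_scal_r.
      apply Series_bound; auto.
      apply (ex_series_scal_r (v j) _ (ex_series_tail u (S N) Hu)). }
    assert (Het : ex_series (fun j => t * v j))
      by apply (ex_series_scal_l (K := R_AbsRing) t v Hv).
    assert (Hed : ex_series (fun j => Series (fun i => F i j) - sum_n (fun i => F i j) N))
      by (eapply ex_series_bound; [exact Hb|exact Het]).
    assert (Hes : ex_series (fun j => Series (fun i => F i j))).
    { eapply ex_series_ext; [|apply (ex_series_add _ _ Hed He)].
      intros j. simpl. ring. }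
    rewrite <- Series_minus by assumption.
    rewrite <- Series_scal_l. now apply Series_bound. }
  apply is_series_lim.
  apply is_lim_seq_spec. intros eps.
  assert (Hz : is_lim_seq (fun N => Series (fun i => u (S N + i)%nat) * Series v) 0).
  { replace (Finite 0) with (Finite (0 * Series v)) by (f_equal; ring).
    apply is_lim_seq_mult'; [|apply is_lim_seq_const]. now apply Series_tail_lim. }
  apply is_lim_seq_spec in Hz. destruct (Hz eps) as [N0 HN0].
  exists N0. intros n Hn. specialize (HN0 n Hn). specialize (Htail n).
  rewrite Rminus_0_r in HN0.
  rewrite Rabs_minus_sym. eapply Rle_lt_trans; [exact Htail|].
  eapply Rle_lt_trans; [apply Rle_abs | exact HN0].
Qed.

Lemma Series_swap (F : nat -> nat -> R) (u v : nat -> R) :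
  (forall n, 0 <= u n) -> (forall n, 0 <= v n) ->
  (forall i j, Rabs (F i j) <= u i * v j) -> ex_series u -> ex_series v ->
  Series (fun i => Series (F i)) = Series (fun j => Series (fun i => F i j)).
Proof. intros. apply is_series_unique. now apply is_series_swap with u v. Qed.

Lemma Series_group2 (t : nat -> R) :
  ex_series t -> Series (fun n => t (2 * n)%nat + t (S (2 * n))) = Series t.
Proof.
  intros Ht. apply is_series_unique, is_series_lim.
  apply (is_lim_seq_ext (fun n => sum_n t (S (2 * n)))).
  - induction n as [|n IH].
    + rewrite !sum_Sn, !sum_O. reflexivity.
    + replace (S (2 * S n)) with (S (S (S (2 * n)))) by lia.
      rewrite !sum_Sn in *. rewrite IH.
      replace (2 * S n)%nat with (S (S (2 * n))) by lia.
      unfold plus; simpl. ring.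
  - apply (is_lim_seq_subseq (sum_n t) (Series t) (fun n => S (2 * n))).
    + apply eventually_subseq. intros n. lia.
    + exact (Series_correct t Ht).
Qed.

(** * Sums over the integers *)

(** Geometric decay is the only form of summability that is used: it is stable under
    shifts, reflection and convolution, and supplies the bound for [sumZ_swap]. *)
Definition geo (f : Z -> R) : Prop :=
  exists C s, 0 < s < 1 /\ forall z, Rabs (f z) <= C * s ^ Z.abs_nat z.

(** Folding [n] with [-1 - n], rather than with [- n], meets every integer exactly once, so
    that no term is treated separately. *)
Definition fold_term (f : Z -> R) (n : nat) : R :=
  f (Z.of_nat n) + f (-1 - Z.of_nat n)%Z.

Definition sumZ (f : Z -> R) : R := Series (fold_term f).

Lemma abs_nat_of_nat (n : nat) : Z.abs_nat (Z.of_nat n) = n.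
Proof. lia. Qed.
Lemma abs_nat_neg (n : nat) : Z.abs_nat (-1 - Z.of_nat n) = S n.
Proof. lia. Qed.

Lemma pow_le_1 (s : R) (n : nat) : 0 < s < 1 -> 0 < s ^ n <= 1.
Proof.
  intros Hs. split; [apply pow_lt; lra|].
  induction n; simpl; [lra|]. assert (0 < s ^ n) by (apply pow_lt; lra). nra.
Qed.

Lemma pow_anti (s : R) (m n : nat) : 0 < s < 1 -> (n <= m)%nat -> s ^ m <= s ^ n.
Proof.
  intros Hs Hmn. replace m with (n + (m - n))%nat by lia. rewrite pow_add.
  pose proof (pow_le_1 s n Hs). pose proof (pow_le_1 s (m - n) Hs). nra.
Qed.

Lemma geo_const_nonneg (f : Z -> R) C s :
  (forall z, Rabs (f z) <= C * s ^ Z.abs_nat z) -> 0 <= C.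
Proof.
  intros H. specialize (H 0%Z). simpl in H. pose proof (Rabs_pos (f 0%Z)). lra.
Qed.

Lemma fold_term_bound (f : Z -> R) C s :
  0 < s < 1 -> (forall z, Rabs (f z) <= C * s ^ Z.abs_nat z) ->
  forall n, Rabs (fold_term f n) <= 2 * C * s ^ n.
Proof.
  intros Hs H n. unfold fold_term.
  pose proof (H (Z.of_nat n)) as H1. pose proof (H (-1 - Z.of_nat n)%Z) as H2.
  rewrite abs_nat_of_nat in H1. rewrite abs_nat_neg in H2.
  pose proof (geo_const_nonneg f C s H).
  pose proof (pow_anti s (S n) n Hs ltac:(lia)).
  eapply Rle_trans; [apply Rabs_triang|]. nra.
Qed.

Lemma geo_ex (f : Z -> R) : geo f -> ex_series (fold_term f).
Proof.
  intros (C & s & Hs & H).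
  eapply ex_series_bound; [now apply fold_term_bound with (C := C) (s := s)|].
  apply ex_series_geom_scal; lra.
Qed.

Lemma sumZ_ext (f g : Z -> R) : (forall z, f z = g z) -> sumZ f = sumZ g.
Proof. intros H. apply Series_ext. intros n. unfold fold_term. now rewrite !H. Qed.

Lemma sumZ_plus (f g : Z -> R) :
  geo f -> geo g -> sumZ (fun z => f z + g z) = sumZ f + sumZ g.
Proof.
  intros Hf Hg. unfold sumZ.
  rewrite <- Series_plus by now apply geo_ex.
  apply Series_ext. intros n. unfold fold_term. ring.
Qed.

Lemma sumZ_scal (c : R) (f : Z -> R) : sumZ (fun z => c * f z) = c * sumZ f.
Proof.
  unfold sumZ. rewrite <- Series_scal_l.
  apply Series_ext. intros n. unfold fold_term. ring.
Qed.

Lemma geo_bounded_mult (b f : Z -> R) M :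
  (forall z, Rabs (b z) <= M) -> geo f -> geo (fun z => b z * f z).
Proof.
  intros Hb (C & s & Hs & H). exists (M * C), s. split; auto.
  intros z. rewrite Rabs_mult, Rmult_assoc.
  apply Rmult_le_compat; auto using Rabs_pos.
Qed.

Lemma geo_scal c (f : Z -> R) : geo f -> geo (fun z => c * f z).
Proof. intros. apply geo_bounded_mult with (M := Rabs c); auto. intros; lra. Qed.

Lemma geo_le (f g : Z -> R) : (forall z, Rabs (f z) <= Rabs (g z)) -> geo g -> geo f.
Proof.
  intros Hb (C & s & Hs & H). exists C, s. split; auto.
  intros z. eapply Rle_trans; eauto.
Qed.

Lemma geo_ext (f g : Z -> R) : (forall z, f z = g z) -> geo g -> geo f.
Proof. intros Hb. apply geo_le. intros z. rewrite Hb. lra. Qed.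

Lemma geo_plus (f g : Z -> R) : geo f -> geo g -> geo (fun z => f z + g z).
Proof.
  intros (C & s & Hs & H) (C' & s' & Hs' & H').
  exists (C + C'), (Rmax s s'). split.
  - split; [apply Rlt_le_trans with s; [lra|apply Rmax_l]|apply Rmax_lub_lt; lra].
  - intros z. specialize (H z); specialize (H' z).
    pose proof (geo_const_nonneg f C s) as HC.
    assert (0 <= C) by (pose proof (Rabs_pos (f z));
      pose proof (pow_le_1 s (Z.abs_nat z) Hs); nra).
    assert (0 <= C') by (pose proof (Rabs_pos (g z));
      pose proof (pow_le_1 s' (Z.abs_nat z) Hs'); nra).
    assert (s ^ Z.abs_nat z <= Rmax s s' ^ Z.abs_nat z)
      by (apply pow_incr; split; [lra|apply Rmax_l]).
    assert (s' ^ Z.abs_nat z <= Rmax s s' ^ Z.abs_nat z)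
      by (apply pow_incr; split; [lra|apply Rmax_r]).
    eapply Rle_trans; [apply Rabs_triang|]. nra.
Qed.

Lemma geo_shift (f : Z -> R) (k : Z) : geo f -> geo (fun z => f (z + k)%Z).
Proof.
  intros (C & s & Hs & H). exists (C * / s ^ Z.abs_nat k), s. split; auto.
  intros z. eapply Rle_trans; [apply H|].
  pose proof (geo_const_nonneg f C s H).
  pose proof (pow_le_1 s (Z.abs_nat k) Hs).
  rewrite Rmult_assoc. apply Rmult_le_compat_l; auto.
  apply Rmult_le_reg_l with (s ^ Z.abs_nat k); [lra|].
  rewrite <- Rmult_assoc, Rinv_r, Rmult_1_l by lra.
  rewrite <- pow_add. apply pow_anti; [auto|lia].
Qed.

Lemma geo_opp_arg (f : Z -> R) : geo f -> geo (fun z => f (- z)%Z).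
Proof.
  intros (C & s & Hs & H). exists C, s. split; auto.
  intros z. replace (Z.abs_nat z) with (Z.abs_nat (- z)) by lia. apply H.
Qed.

Lemma geo_lim (f : Z -> R) : geo f ->
  is_lim_seq (fun n => f (Z.of_nat n)) 0 /\ is_lim_seq (fun n => f (- Z.of_nat n)%Z) 0.
Proof.
  intros (C & s & Hs & H).
  assert (Hg : is_lim_seq (fun n => C * s ^ n) 0).
  { replace (Finite 0) with (Finite (C * 0)) by (f_equal; ring).
    apply is_lim_seq_mult'; [apply is_lim_seq_const|].
    apply is_lim_seq_geom. rewrite Rabs_pos_eq; lra. }
  split; apply is_lim_seq_abs_0;
    (apply is_lim_seq_le_le with (u := fun _ => 0) (w := fun n => C * s ^ n);
     [|apply is_lim_seq_const|exact Hg]);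
    intros n; split; try apply Rabs_pos; eapply Rle_trans; try apply H;
    apply Req_le; do 2 f_equal; lia.
Qed.

Lemma is_series_telescope (g : nat -> R) (l : R) :
  is_lim_seq g l -> is_series (fun n => g (S n) - g n) (l - g 0%nat).
Proof.
  intros Hg. apply is_series_lim. apply (is_lim_seq_ext (fun n => g (S n) - g 0%nat)).
  - induction n as [|n IH]; [now rewrite sum_O|].
    rewrite sum_Sn, <- IH. unfold plus; simpl. ring.
  - apply is_lim_seq_minus'; [|apply is_lim_seq_const].
    now apply (is_lim_seq_incr_1 g).
Qed.

Lemma sumZ_telescope (g : Z -> R) (lp lm : R) :
  is_lim_seq (fun n => g (Z.of_nat n)) lp ->
  is_lim_seq (fun n => g (- Z.of_nat n)%Z) lm ->
  sumZ (fun z => g (z + 1)%Z - g z) = lp - lm.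
Proof.
  intros Hp Hm. unfold sumZ. apply is_series_unique.
  apply is_series_ext with
    (a := fun n => plus (g (Z.of_nat (S n)) - g (Z.of_nat n))
                        (opp (g (- Z.of_nat (S n))%Z - g (- Z.of_nat n)%Z))).
  - intros n. unfold fold_term, plus, opp; simpl plus.
    replace (-1 - Z.of_nat n + 1)%Z with (- Z.of_nat n)%Z by lia.
    replace (-1 - Z.of_nat n)%Z with (- Z.of_nat (S n))%Z by lia.
    replace (Z.of_nat (S n)) with (Z.of_nat n + 1)%Z by lia. simpl. ring.
  - replace (lp - lm) with (plus (lp - g 0%Z) (opp (lm - g 0%Z)))
      by (unfold plus, opp; simpl; ring).
    apply (is_series_plus (K := R_AbsRing) (V := R_NormedModule)).
    + now apply (is_series_telescope (fun n => g (Z.of_nat n))).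
    + apply (is_series_opp (K := R_AbsRing) (V := R_NormedModule)).
      now apply (is_series_telescope (fun n => g (- Z.of_nat n)%Z)).
Qed.

Lemma sumZ_minus (f g : Z -> R) :
  geo f -> geo g -> sumZ (fun z => f z - g z) = sumZ f - sumZ g.
Proof.
  intros Hf Hg.
  replace (sumZ f - sumZ g) with (sumZ f + (-1) * sumZ g) by ring.
  rewrite <- sumZ_scal, <- sumZ_plus by auto using geo_scal.
  apply sumZ_ext. intros z. ring.
Qed.

(** The folded terms of the difference telescope on both half-lines, to
    [- f 0] and [f 0]. *)
Lemma sumZ_shift1 (f : Z -> R) : geo f -> sumZ (fun z => f (z + 1)%Z) = sumZ f.
Proof.
  intros Hf. apply Rminus_diag_uniq.
  rewrite <- sumZ_minus by (auto; now apply geo_shift).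
  destruct (geo_lim f Hf) as [H1 H2].
  rewrite (sumZ_telescope f 0 0) by assumption. ring.
Qed.

Lemma sumZ_shift (f : Z -> R) (k : Z) : geo f -> sumZ (fun z => f (z + k)%Z) = sumZ f.
Proof.
  intros Hf. revert k.
  assert (Hs : forall k, sumZ (fun z => f (z + (k + 1))%Z) = sumZ (fun z => f (z + k)%Z)).
  { intros k. rewrite <- (sumZ_shift1 (fun z => f (z + k)%Z)) by now apply geo_shift.
    apply sumZ_ext. intros z. f_equal. lia. }
  apply Z.bi_induction.
  - intros x y ->. tauto.
  - apply sumZ_ext. intros z. f_equal. lia.
  - intros k. unfold Z.succ. rewrite Hs. tauto.
Qed.

Lemma sumZ_opp_arg (f : Z -> R) : geo f -> sumZ (fun z => f (- z)%Z) = sumZ f.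
Proof.
  intros Hf. rewrite <- (sumZ_shift1 (fun z => f (- z)%Z)) by now apply geo_opp_arg.
  apply Series_ext. intros n. unfold fold_term.
  replace (- (Z.of_nat n + 1))%Z with (-1 - Z.of_nat n)%Z by lia.
  replace (- (-1 - Z.of_nat n + 1))%Z with (Z.of_nat n) by lia. ring.
Qed.

Lemma sumZ_reflect (f : Z -> R) (k : Z) : geo f -> sumZ (fun z => f (k - z)%Z) = sumZ f.
Proof.
  intros Hf. rewrite <- (sumZ_shift f k Hf).
  rewrite <- (sumZ_opp_arg (fun z => f (z + k)%Z)) by now apply geo_shift.
  apply sumZ_ext. intros z. f_equal. lia.
Qed.

(** The pairing of [n] with [-1 - n] is compatible with splitting by parity: the folded
    terms of the left-hand side are the sums of two consecutive folded terms of [f]. *)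
Lemma sumZ_even_odd (f : Z -> R) :
  geo f -> sumZ (fun z => f (2 * z)%Z + f (2 * z + 1)%Z) = sumZ f.
Proof.
  intros Hf. unfold sumZ.
  rewrite <- (Series_group2 (fold_term f)) by now apply geo_ex.
  apply Series_ext. intros n. unfold fold_term.
  replace (Z.of_nat (2 * n)) with (2 * Z.of_nat n)%Z by lia.
  replace (Z.of_nat (S (2 * n))) with (2 * Z.of_nat n + 1)%Z by lia.
  replace (-1 - (2 * Z.of_nat n + 1))%Z with (2 * (-1 - Z.of_nat n))%Z by lia.
  replace (2 * (-1 - Z.of_nat n) + 1)%Z with (-1 - 2 * Z.of_nat n)%Z by lia.
  ring.
Qed.

Lemma sumZ_ge_term (f : Z -> R) (n : nat) :
  geo f -> (forall z, 0 <= f z) -> f (Z.of_nat n) + f (-1 - Z.of_nat n)%Z <= sumZ f.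
Proof.
  intros Hf H0. unfold sumZ.
  rewrite (Series_incr_n (fold_term f) (S n)) by (try lia; now apply geo_ex).
  assert (Hn : forall m, 0 <= fold_term f m)
    by (intros m; unfold fold_term; pose proof (H0 (Z.of_nat m));
        pose proof (H0 (-1 - Z.of_nat m)%Z); lra).
  pose proof (Series_nonneg (fun k => fold_term f (S n + k)%nat) (fun k => Hn _)
                (ex_series_tail _ (S n) (geo_ex f Hf))).
  simpl pred. fold (fold_term f n).
  assert (fold_term f n <= sum_f_R0 (fold_term f) n).
  { destruct n; simpl; [lra|].
    pose proof (cond_pos_sum (fold_term f) n Hn). lra. }
  lra.
Qed.

Lemma sumZ_zero (f : Z -> R) : (forall z, f z = 0) -> sumZ f = 0.
Proof.
  intros H. rewrite (sumZ_ext f (fun z => 0 * f z)) by (intros; rewrite H; ring).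
  rewrite sumZ_scal. ring.
Qed.

Lemma sumZ_single (f : Z -> R) : geo f -> (forall z, z <> 0%Z -> f z = 0) -> sumZ f = f 0%Z.
Proof.
  intros Hf H. unfold sumZ. rewrite Series_incr_1 by now apply geo_ex.
  rewrite (Series_ext _ (fun n => 0 * fold_term f (S n))).
  - rewrite Series_scal_l. unfold fold_term. rewrite (H (-1 - Z.of_nat 0)%Z) by lia. simpl. ring.
  - intros n. unfold fold_term. rewrite !H by lia. ring.
Qed.

Lemma sumZ_swap (F : Z -> Z -> R) (C s : R) :
  0 < s < 1 ->
  (forall i j, Rabs (F i j) <= C * (s ^ Z.abs_nat i * s ^ Z.abs_nat j)) ->
  sumZ (fun i => sumZ (F i)) = sumZ (fun j => sumZ (fun i => F i j)).
Proof.
  intros Hs HF.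
  assert (HC : 0 <= C)
    by (specialize (HF 0%Z 0%Z); simpl in HF; pose proof (Rabs_pos (F 0%Z 0%Z)); lra).
  assert (Hr : forall i, geo (F i)).
  { intros i. exists (C * s ^ Z.abs_nat i), s. split; auto.
    intros j. rewrite Rmult_assoc. apply HF. }
  assert (Hc : forall j, geo (fun i => F i j)).
  { intros j. exists (C * s ^ Z.abs_nat j), s. split; auto.
    intros i. eapply Rle_trans; [apply HF|]. apply Req_le; ring. }
  unfold sumZ at 1 3.
  rewrite (Series_ext (fold_term (fun i => sumZ (F i)))
    (fun m => Series (fun n => fold_term (F (Z.of_nat m)) n
       + fold_term (F (-1 - Z.of_nat m)%Z) n)))
    by (intros m; unfold fold_term at 1, sumZ; symmetry; apply Series_plus; now apply geo_ex).
  rewrite (Series_swap _ (fun m => 4 * C * s ^ m) (fun n => s ^ n)).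
  - apply Series_ext. intros n. unfold fold_term at 3, sumZ.
    rewrite <- Series_plus by now apply geo_ex.
    apply Series_ext. intros m. unfold fold_term. ring.
  - intros m. pose proof (pow_le_1 s m Hs). nra.
  - intros m. pose proof (pow_le_1 s m Hs). lra.
  - intros m n.
    assert (Hb : forall i, Rabs (fold_term (F i) n) <= 2 * (C * s ^ Z.abs_nat i) * s ^ n).
    { intros i. apply fold_term_bound; auto. intros j. rewrite Rmult_assoc. apply HF. }
    pose proof (Hb (Z.of_nat m)) as H1. pose proof (Hb (-1 - Z.of_nat m)%Z) as H2.
    rewrite abs_nat_of_nat in H1. rewrite abs_nat_neg in H2.
    pose proof (pow_anti s (S m) m Hs ltac:(lia)).
    pose proof (pow_le_1 s n Hs).
    assert (C * s ^ n * s ^ S m <= C * s ^ n * s ^ m)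
      by (apply Rmult_le_compat_l; auto; nra).
    eapply Rle_trans; [apply Rabs_triang|]. nra.
  - apply ex_series_geom_scal; lra.
  - exists (/ (1 - s)). apply is_series_geom. rewrite Rabs_pos_eq; lra.
Qed.

(** Since [|j| + |n - j|] is at least both [|n|] and [|j|], it is at least their mean; this
    is why the common ratio is a square root. *)
Lemma geo_convolution_bound (f g : Z -> R) : geo f -> geo g ->
  exists C s, 0 < s < 1 /\
  forall n j, Rabs (f j * g (n - j)%Z) <= C * (s ^ Z.abs_nat n * s ^ Z.abs_nat j).
Proof.
  intros (C & s & Hs & H) (C' & s' & Hs' & H').
  set (r := Rmax s s').
  assert (Hr : 0 < r < 1)
    by (split; [apply Rlt_le_trans with s; [lra|apply Rmax_l]|apply Rmax_lub_lt; lra]).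
  assert (Hq : 0 < sqrt r < 1).
  { split; [apply sqrt_lt_R0; lra|]. rewrite <- sqrt_1. apply sqrt_lt_1; lra. }
  assert (Hqq : r = sqrt r ^ 2) by (simpl; rewrite Rmult_1_r, sqrt_sqrt; lra).
  exists (C * C'), (sqrt r). split; auto.
  intros n j. specialize (H j). specialize (H' (n - j)%Z).
  rewrite Rabs_mult.
  assert (0 <= C) by (pose proof (Rabs_pos (f j));
      pose proof (pow_le_1 s (Z.abs_nat j) Hs); nra).
  assert (0 <= C') by (pose proof (Rabs_pos (g (n - j)%Z));
      pose proof (pow_le_1 s' (Z.abs_nat (n - j)) Hs'); nra).
  apply Rle_trans with ((C * s ^ Z.abs_nat j) * (C' * s' ^ Z.abs_nat (n - j))).
  { apply Rmult_le_compat; auto using Rabs_pos. }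
  assert (s ^ Z.abs_nat j <= r ^ Z.abs_nat j)
      by (apply pow_incr; split; [lra|apply Rmax_l]).
  assert (s' ^ Z.abs_nat (n - j) <= r ^ Z.abs_nat (n - j))
      by (apply pow_incr; split; [lra|apply Rmax_r]).
  apply Rle_trans with ((C * C') * (r ^ Z.abs_nat j * r ^ Z.abs_nat (n - j))).
  { replace (C * s ^ Z.abs_nat j * (C' * s' ^ Z.abs_nat (n - j)))
      with (C * C' * (s ^ Z.abs_nat j * s' ^ Z.abs_nat (n - j))) by ring.
    apply Rmult_le_compat_l; [nra|].
    pose proof (pow_le_1 s (Z.abs_nat j) Hs).
    pose proof (pow_le_1 s' (Z.abs_nat (n - j)) Hs').
    apply Rmult_le_compat; lra. }
  apply Rmult_le_compat_l; [nra|].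
  replace (r ^ Z.abs_nat j * r ^ Z.abs_nat (n - j))
    with (sqrt r ^ (2 * Z.abs_nat j + 2 * Z.abs_nat (n - j)))
    by (rewrite pow_add, !pow_mult, <- Hqq; reflexivity).
  rewrite <- pow_add. apply pow_anti; [auto|lia].
Qed.

Lemma sumZ_mult (f g : Z -> R) : geo f -> geo g ->
  sumZ f * sumZ g = sumZ (fun n => sumZ (fun j => f j * g (n - j)%Z)).
Proof.
  intros Hf Hg. destruct (geo_convolution_bound f g Hf Hg) as (C & s & Hs & HF).
  rewrite (sumZ_swap _ C s Hs HF).
  rewrite Rmult_comm, <- sumZ_scal. apply sumZ_ext. intros j.
  rewrite sumZ_scal, Rmult_comm. f_equal.
  rewrite <- (sumZ_shift g (- j)) by assumption.
  apply sumZ_ext. intros n. f_equal.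
Qed.

Lemma geo_convolution (f g : Z -> R) : geo f -> geo g ->
  geo (fun n => sumZ (fun j => f j * g (n - j)%Z)).
Proof.
  intros Hf Hg. destruct (geo_convolution_bound f g Hf Hg) as (C & s & Hs & HF).
  exists (2 * C * Series (fun n => s ^ n)), s. split; auto.
  intros n. unfold sumZ.
  replace (2 * C * Series (fun n => s ^ n) * s ^ Z.abs_nat n)
    with ((2 * (C * s ^ Z.abs_nat n)) * Series (fun n => s ^ n)) by ring.
  rewrite <- Series_scal_l. apply Series_bound.
  - intros m. apply fold_term_bound; auto.
    intros j. rewrite Rmult_assoc. apply HF.
  - apply ex_series_geom_scal; lra.
Qed.

Lemma geo_convolution_term (f g : Z -> R) (n : Z) : geo f -> geo g ->
  geo (fun j => f j * g (n - j)%Z).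
Proof.
  intros Hf Hg. destruct (geo_convolution_bound f g Hf Hg) as (C & s & Hs & HF).
  exists (C * s ^ Z.abs_nat n), s. split; auto.
  intros j. rewrite Rmult_assoc. apply HF.
Qed.

(** * Hyperbolic secant and alternating signs *)

Lemma cosh_pos (x : R) : 0 < cosh x.
Proof. unfold cosh. pose proof (exp_pos x). pose proof (exp_pos (- x)). lra. Qed.

Lemma exp_mul_exp_opp (x : R) : exp x * exp (- x) = 1.
Proof. rewrite <- exp_plus, Rplus_opp_r. apply exp_0. Qed.

Lemma cosh_opp (x : R) : cosh (- x) = cosh x.
Proof. unfold cosh. rewrite Ropp_involutive. field. Qed.

Lemma sech_pos (x : R) : 0 < sech x.
Proof. unfold sech. apply Rdiv_lt_0_compat; [lra|apply cosh_pos]. Qed.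

Lemma sech_opp (x : R) : sech (- x) = sech x.
Proof. unfold sech. now rewrite cosh_opp. Qed.

Lemma sech_0 : sech 0 = 1.
Proof. unfold sech. rewrite cosh_0. field. Qed.

Lemma sech_upper (x : R) : sech x <= 2 * exp (- Rabs x).
Proof.
  assert (H : forall y, 0 <= y -> sech y <= 2 * exp (- y)).
  { intros y Hy. unfold sech. apply Rmult_le_reg_r with (cosh y); [apply cosh_pos|].
    unfold Rdiv. rewrite Rmult_1_l, Rinv_l by (pose proof (cosh_pos y); lra).
    unfold cosh. pose proof (exp_mul_exp_opp y). pose proof (exp_pos (- y)). nra. }
  destruct (Rle_dec 0 x) as [Hx|Hx].
  - rewrite Rabs_pos_eq by assumption. now apply H.
  - rewrite <- sech_opp, Rabs_left by lra. apply H; lra.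
Qed.

Lemma sech_lower (x : R) : 0 <= x -> exp (- x) <= sech x.
Proof.
  intros Hx. unfold sech. apply Rmult_le_reg_r with (cosh x); [apply cosh_pos|].
  unfold Rdiv. rewrite Rmult_1_l, Rinv_l by (pose proof (cosh_pos x); lra).
  unfold cosh. pose proof (exp_mul_exp_opp x). pose proof (exp_pos (- x)).
  assert (exp (- x) <= 1) by (rewrite <- exp_0; destruct Hx as [Hx| <-];
    [left; apply exp_increasing; lra | rewrite Ropp_0; lra]). nra.
Qed.

Lemma tanh_minus (x y : R) : tanh x - tanh y = sinh (x - y) * (sech x * sech y).
Proof.
  unfold tanh, sech.
  pose proof (cosh_pos x). pose proof (cosh_pos y).
  replace (sinh (x - y)) with (sinh x * cosh y - cosh x * sinh y).
  - field. lra.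
  - unfold sinh, cosh. unfold Rminus. rewrite Ropp_plus_distr, !exp_plus, Ropp_involutive. field.
Qed.

Lemma tanh_opp (x : R) : tanh (- x) = - tanh x.
Proof.
  unfold tanh. rewrite cosh_opp. unfold sinh. rewrite Ropp_involutive.
  pose proof (cosh_pos x). field. lra.
Qed.

Lemma sinh_double (x : R) : sinh (2 * x) = 2 * sinh x * cosh x.
Proof.
  unfold sinh, cosh. replace (2 * x) with (x + x) by ring.
  rewrite Ropp_plus_distr, !exp_plus. field.
Qed.

Lemma sinh_neq_0 (x : R) : x <> 0 -> sinh x <> 0.
Proof.
  intros Hx. unfold sinh. intros H.
  assert (He : exp x = exp (- x)) by lra. apply exp_inv in He. lra.
Qed.

Lemma exp_INR_mult (n : nat) (x : R) : exp (INR n * x) = exp x ^ n.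
Proof.
  induction n as [|n IH].
  - simpl. rewrite Rmult_0_l. apply exp_0.
  - rewrite S_INR, Rmult_plus_distr_r, Rmult_1_l, exp_plus, IH. simpl. ring.
Qed.

Lemma Rabs_IZR (z : Z) : Rabs (IZR z) = INR (Z.abs_nat z).
Proof. rewrite Rabs_Zabs, INR_IZR_INZ. f_equal. lia. Qed.

Lemma exp_neg_bounds (h : R) : 0 < h -> 0 < exp (- h) < 1.
Proof.
  intros Hh. split; [apply exp_pos|]. rewrite <- exp_0. apply exp_increasing. lra.
Qed.

Lemma sechZ_upper (h : R) (z : Z) : 0 < h ->
  sech (IZR z * h) <= 2 * exp (- h) ^ Z.abs_nat z.
Proof.
  intros Hh. eapply Rle_trans; [apply sech_upper|].
  rewrite Rabs_mult, (Rabs_pos_eq h), Rabs_IZR by lra.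
  rewrite Ropp_mult_distr_r, exp_INR_mult. lra.
Qed.

Definition sgn (z : Z) : R := if Z.even z then 1 else -1.

Lemma sgn_add (x y : Z) : sgn (x + y) = sgn x * sgn y.
Proof. unfold sgn. rewrite Z.even_add. destruct (Z.even x), (Z.even y); simpl; ring. Qed.

Lemma sgn_opp (x : Z) : sgn (- x) = sgn x.
Proof. unfold sgn. now rewrite Z.even_opp. Qed.

Lemma sgn_sub (x y : Z) : sgn (x - y) = sgn x * sgn y.
Proof. unfold Z.sub. now rewrite sgn_add, sgn_opp. Qed.

Lemma sgn_abs (x : Z) : Rabs (sgn x) = 1.
Proof. unfold sgn. destruct (Z.even x); [apply Rabs_R1|]. rewrite Rabs_left; lra. Qed.

Lemma sgn_double (x : Z) : sgn (2 * x) = 1.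
Proof. unfold sgn. rewrite Z.even_mul. reflexivity. Qed.

Lemma sgn_succ_double (x : Z) : sgn (2 * x + 1) = -1.
Proof. rewrite sgn_add, sgn_double. unfold sgn. simpl. ring. Qed.

(** * Convolutions of hyperbolic secants *)

Section Weights.
Variable h : R.
Hypothesis Hh : 0 < h.

Let a (z : Z) : R := sech (IZR z * h).

Lemma geo_sech : geo a.
Proof.
  exists 2, (exp (- h)). split; [now apply exp_neg_bounds|].
  intros z. unfold a. rewrite Rabs_pos_eq by (left; apply sech_pos). now apply sechZ_upper.
Qed.

Lemma geo_weighted_sech (w : Z -> R) : (forall z, Rabs (w z) <= 1) -> geo (fun z => w z * a z).
Proof. intros Hw. apply geo_bounded_mult with 1; [assumption|apply geo_sech]. Qed.

Lemma sech_even (z : Z) : a (- z) = a z.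
Proof. unfold a. rewrite opp_IZR, <- Ropp_mult_distr_l. apply sech_opp. Qed.

(** The identity that makes the convolutions of [a] telescope. *)
Lemma tanh_step (n j : Z) :
  tanh (IZR j * h) - tanh (IZR (j - n) * h) = sinh (IZR n * h) * (a j * a (n - j)).
Proof.
  rewrite tanh_minus, <- (sech_even (n - j)). unfold a.
  replace (- (n - j))%Z with (j - n)%Z by lia.
  do 2 f_equal. rewrite minus_IZR. ring.
Qed.

Lemma geo_tanh_step (w : Z -> R) (n : Z) : (forall z, Rabs (w z) <= 1) ->
  geo (fun j => w j * (tanh (IZR j * h) - tanh (IZR (j - n) * h))).
Proof.
  intros Hw. apply geo_bounded_mult with 1; [assumption|].
  apply geo_ext with (fun j => sinh (IZR n * h) * (a j * a (n - j)%Z)).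
  - intros j. apply tanh_step.
  - apply geo_scal. apply geo_convolution_term; apply geo_sech.
Qed.

(** Passing from [n] to [n + 1] adds the unit step at [j - n], which a shift of the
    summation index turns into the unit step at [j], times [w n]. *)
Lemma tanh_steps_additive (w : Z -> R) (n : Z) :
  (forall z, Rabs (w z) <= 1) -> (forall x y, w (x + y)%Z = w x * w y) ->
  let b m := sumZ (fun j => w j * (tanh (IZR j * h) - tanh (IZR (j - m) * h))) in
  b (n + 1)%Z = b n + w n * b 1%Z.
Proof.
  intros Hw Hm b. unfold b.
  rewrite <- sumZ_scal.
  rewrite <- (sumZ_shift (fun z => w n * (w z * (tanh (IZR z * h) - tanh (IZR (z - 1) * h)))) (- n))
    by (apply geo_scal; now apply geo_tanh_step).
  rewrite <- sumZ_plus.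
  - apply sumZ_ext. intros j.
    replace (w j) with (w n * w (j + - n)%Z) by (rewrite <- Hm; f_equal; lia).
    replace (j + - n)%Z with (j - n)%Z by lia.
    replace (j - n - 1)%Z with (j - (n + 1))%Z by lia. ring.
  - now apply geo_tanh_step.
  - apply (geo_shift (fun z => w n * (w z * (tanh (IZR z * h) - tanh (IZR (z - 1) * h)))) (- n)).
    apply geo_scal; now apply geo_tanh_step.
Qed.

Lemma tanh_lim : is_lim_seq (fun n => tanh (INR n * h)) 1.
Proof.
  apply is_lim_seq_ext with (fun n => (1 - (exp (- h) ^ 2) ^ n) / (1 + (exp (- h) ^ 2) ^ n)).
  - intros n. rewrite <- pow_mult, Nat.mul_comm, pow_mult, <- exp_INR_mult.
    unfold tanh, sinh, cosh.
    replace (- (INR n * h)) with (INR n * - h) by ring.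
    set (x := INR n * h). replace (INR n * - h) with (- x) by (unfold x; ring).
    pose proof (exp_pos x). pose proof (exp_pos (- x)).
    replace (exp x) with (/ exp (- x)) by (rewrite exp_Ropp, Rinv_inv; reflexivity).
    field. nra.
  - pose proof (exp_neg_bounds h Hh).
    assert (Hg : is_lim_seq (fun n => (exp (- h) ^ 2) ^ n) 0).
    { apply is_lim_seq_geom. rewrite Rabs_pos_eq; nra. }
    replace (Finite 1) with (Finite ((1 - 0) / (1 + 0))) by (f_equal; field).
    apply is_lim_seq_div'; [| |lra].
    + apply is_lim_seq_minus'; [apply is_lim_seq_const|exact Hg].
    + apply is_lim_seq_plus'; [apply is_lim_seq_const|exact Hg].
Qed.

(** The steps add up to the total increase of [tanh], from [-1] to [1]. *)
Lemma sum_tanh_step : sumZ (fun j => 1 * (tanh (IZR j * h) - tanh (IZR (j - 1) * h))) = 2.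
Proof.
  rewrite <- (sumZ_shift _ 1) by (apply geo_tanh_step; intros; rewrite Rabs_R1; lra).
  rewrite (sumZ_ext _ (fun j => tanh (IZR (j + 1) * h) - tanh (IZR j * h))).
  - rewrite (sumZ_telescope (fun j => tanh (IZR j * h)) 1 (-1)); [ring| |].
    + apply is_lim_seq_ext with (2 := tanh_lim). intros n. now rewrite INR_IZR_INZ.
    + apply is_lim_seq_ext with (fun n => - tanh (INR n * h)).
      * intros n. rewrite opp_IZR, <- INR_IZR_INZ, <- tanh_opp. f_equal. ring.
      * replace (Finite (-1)) with (Rbar_opp (Finite 1)) by reflexivity.
        apply is_lim_seq_opp. rewrite Rbar_opp_involutive.
        apply is_lim_seq_ext with (2 := tanh_lim). intros; ring.
  - intros j. replace (j + 1 - 1)%Z with j by lia. ring.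
Qed.

(** The reflection of [j] to [1 - j] keeps each step of [tanh] and flips the factor
    [sgn j]. *)
Lemma sum_sgn_tanh_step :
  sumZ (fun j => sgn j * (tanh (IZR j * h) - tanh (IZR (j - 1) * h))) = 0.
Proof.
  set (f := fun j => sgn j * (tanh (IZR j * h) - tanh (IZR (j - 1) * h))).
  assert (Hf : geo f) by (apply geo_tanh_step; intros; rewrite sgn_abs; lra).
  pose proof (sumZ_reflect f 1 Hf) as H.
  rewrite (sumZ_ext (fun z => f (1 - z)%Z) (fun z => (-1) * f z)) in H.
  - rewrite sumZ_scal in H. lra.
  - intros z. unfold f. rewrite sgn_sub.
    replace (1 - z - 1)%Z with (- z)%Z by lia.
    replace (1 - z)%Z with (- (z - 1))%Z by lia.
    rewrite !opp_IZR, <- !Ropp_mult_distr_l, !tanh_opp.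
    change (sgn 1) with (-1). ring.
Qed.

Lemma convolution_sech (n : Z) : n <> 0%Z ->
  sumZ (fun j => a j * a (n - j)%Z) = 2 * IZR n / sinh (IZR n * h).
Proof.
  intros Hn.
  assert (Hs : sinh (IZR n * h) <> 0)
    by (apply sinh_neq_0; apply Rmult_integral_contrapositive; split; [now apply not_0_IZR|lra]).
  assert (Hb : forall m, sumZ (fun j => 1 * (tanh (IZR j * h) - tanh (IZR (j - m) * h)))
               = 2 * IZR m).
  { pose proof (fun m => tanh_steps_additive (fun _ => 1) m
       (fun _ => Req_le _ _ Rabs_R1) (fun _ _ => eq_sym (Rmult_1_r 1))) as Ha.
    cbv beta zeta in Ha. rewrite sum_tanh_step in Ha.
    apply Z.bi_induction.
    - intros x y H; change (x = y) in H; subst y; reflexivity.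
    - rewrite sumZ_zero; [simpl; ring|]. intros z. rewrite Z.sub_0_r. ring.
    - intros m. unfold Z.succ. rewrite Ha, plus_IZR. split; lra. }
  specialize (Hb n). rewrite <- Hb.
  rewrite (sumZ_ext (fun j => 1 * (tanh (IZR j * h) - tanh (IZR (j - n) * h)))
     (fun j => sinh (IZR n * h) * (a j * a (n - j)%Z)))
    by (intros; rewrite tanh_step; ring).
  rewrite sumZ_scal. field. assumption.
Qed.

Lemma convolution_sgn_sech (n : Z) : n <> 0%Z ->
  sumZ (fun j => sgn j * (a j * a (n - j)%Z)) = 0.
Proof.
  intros Hn.
  assert (Hs : sinh (IZR n * h) <> 0)
    by (apply sinh_neq_0; apply Rmult_integral_contrapositive; split; [now apply not_0_IZR|lra]).
  assert (Hb : forall m, sumZ (fun j => sgn j * (tanh (IZR j * h) - tanh (IZR (j - m) * h)))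
               = 0).
  { pose proof (fun m => tanh_steps_additive sgn m
       (fun z => Req_le _ _ (sgn_abs z)) sgn_add) as Ha.
    cbv beta zeta in Ha. rewrite sum_sgn_tanh_step in Ha.
    apply Z.bi_induction.
    - intros x y H; change (x = y) in H; subst y; reflexivity.
    - apply sumZ_zero. intros z. rewrite Z.sub_0_r. ring.
    - intros m. unfold Z.succ. rewrite Ha. split; lra. }
  specialize (Hb n).
  rewrite (sumZ_ext (fun j => sgn j * (tanh (IZR j * h) - tanh (IZR (j - n) * h)))
     (fun j => sinh (IZR n * h) * (sgn j * (a j * a (n - j)%Z)))) in Hb
    by (intros; rewrite tanh_step; ring).
  rewrite sumZ_scal in Hb. apply Rmult_integral in Hb. tauto.
Qed.

(** The weight [c] factors out of the [n]-th convolution coefficient, which is zero unless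
    [n = 0]; so the product does not depend on the character [c]. *)
Lemma alternating_product (c : Z -> R) :
  (forall x y, c (x + y)%Z = c x * c y) -> c 0%Z = 1 -> geo (fun z => c z * a z) ->
  sumZ (fun z => c z * a z) * sumZ (fun z => sgn z * (c z * a z))
  = sumZ (fun z => sgn z * (a z * a z)).
Proof.
  intros Hc Hc0 Hg.
  assert (Hg' : geo (fun z => sgn z * (c z * a z)))
    by (apply geo_bounded_mult with 1; [intros; rewrite sgn_abs; lra|assumption]).
  rewrite sumZ_mult by assumption.
  assert (He : forall n, sumZ (fun j => c j * a j * (sgn (n - j) * (c (n - j)%Z * a (n - j)%Z)))
          = sgn n * c n * sumZ (fun j => sgn j * (a j * a (n - j)%Z))).
  { intros n. rewrite <- sumZ_scal. apply sumZ_ext. intros j.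
    rewrite sgn_sub. replace (c n) with (c j * c (n - j)%Z) by (rewrite <- Hc; f_equal; lia).
    ring. }
  rewrite sumZ_single.
  - rewrite He, Hc0. change (sgn 0) with 1. rewrite !Rmult_1_l.
    apply sumZ_ext. intros j. simpl Z.sub. now rewrite sech_even.
  - now apply (geo_convolution _ _ Hg Hg').
  - intros n Hn. rewrite He, convolution_sgn_sech by assumption. ring.
Qed.

(** [cos (z * PI / 2)] and [sin (z * PI / 2)]: the real and imaginary parts of [i ^ z],
    which allow [D] to be evaluated at [x = i] with real numbers. *)
Definition cos_quarter (z : Z) : R := if Z.even z then sgn (z / 2) else 0.
Definition sin_quarter (z : Z) : R := if Z.even z then 0 else sgn (z / 2).

Lemma cos_quarter_double (z : Z) : cos_quarter (2 * z) = sgn z.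
Proof.
  unfold cos_quarter. rewrite Z.even_mul. change (sgn (2 * z / 2) = sgn z). f_equal.
  symmetry. apply Z.div_unique with 0%Z; lia.
Qed.

Lemma cos_quarter_succ_double (z : Z) : cos_quarter (2 * z + 1) = 0.
Proof. unfold cos_quarter. now rewrite Z.even_add, Z.even_mul. Qed.

Lemma sin_quarter_double (z : Z) : sin_quarter (2 * z) = 0.
Proof. unfold sin_quarter. now rewrite Z.even_mul. Qed.

Lemma sin_quarter_succ_double (z : Z) : sin_quarter (2 * z + 1) = sgn z.
Proof.
  unfold sin_quarter. rewrite Z.even_add, Z.even_mul.
  change (sgn ((2 * z + 1) / 2) = sgn z). f_equal.
  symmetry. apply Z.div_unique with 1%Z; lia.
Qed.

Lemma even_or_odd (z : Z) : (exists y, z = 2 * y)%Z \/ (exists y, z = 2 * y + 1)%Z.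
Proof.
  destruct (Z.Even_or_Odd z) as [[y Hy]|[y Hy]]; [left|right]; now exists y.
Qed.

(** The real part of [i^j * (- i)^k = i^(j + k) * (-1)^k]. *)
Lemma quarter_product (j k : Z) :
  cos_quarter j * cos_quarter k + sin_quarter j * sin_quarter k
  = cos_quarter (j + k) * sgn k.
Proof.
  destruct (even_or_odd j) as [[x ->]|[x ->]]; destruct (even_or_odd k) as [[y ->]|[y ->]];
    rewrite ?cos_quarter_double, ?cos_quarter_succ_double, ?sin_quarter_double,
      ?sin_quarter_succ_double, ?sgn_double, ?sgn_succ_double.
  - replace (2 * x + 2 * y)%Z with (2 * (x + y))%Z by lia.
    rewrite cos_quarter_double, sgn_add. ring.
  - replace (2 * x + (2 * y + 1))%Z with (2 * (x + y) + 1)%Z by lia.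
    rewrite cos_quarter_succ_double. ring.
  - replace (2 * x + 1 + 2 * y)%Z with (2 * (x + y) + 1)%Z by lia.
    rewrite cos_quarter_succ_double. ring.
  - replace (2 * x + 1 + (2 * y + 1))%Z with (2 * (x + y + 1))%Z by lia.
    rewrite cos_quarter_double, !sgn_add. change (sgn 1) with (-1). ring.
Qed.

Lemma quarter_bound (z : Z) : Rabs (cos_quarter z) <= 1 /\ Rabs (sin_quarter z) <= 1.
Proof.
  unfold cos_quarter, sin_quarter.
  destruct (Z.even z); rewrite sgn_abs, Rabs_R0; lra.
Qed.

Lemma sin_quarter_opp (z : Z) : sin_quarter (- z) = - sin_quarter z.
Proof.
  destruct (even_or_odd z) as [[x ->]|[x ->]].
  - replace (- (2 * x))%Z with (2 * - x)%Z by lia. rewrite !sin_quarter_double. ring.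
  - replace (- (2 * x + 1))%Z with (2 * (- x - 1) + 1)%Z by lia.
    rewrite !sin_quarter_succ_double, sgn_sub, sgn_opp. change (sgn 1) with (-1). ring.
Qed.

End Weights.

(** * The arithmetic-geometric mean pair *)

(** With [exp (- h)] the nome of modulus [k], the four sums are
    [sumA h = 2 K / PI], [sumB h = k' sumA h], [sumU h = sqrt (1 + k) sumA h] and
    [sumV h = sqrt (1 - k) sumA h]; [sumA] and [sumB] are squares of theta constants. *)
Definition sumA (h : R) : R := sumZ (fun z => sech (IZR z * h)).
Definition sumB (h : R) : R := sumZ (fun z => sgn z * sech (IZR z * h)).

Lemma sgn_le_1 (z : Z) : Rabs (sgn z) <= 1.
Proof. rewrite sgn_abs. lra. Qed.

Lemma sumA_double (h : R) : 0 < h -> sumA (2 * h) = (sumA h + sumB h) / 2.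
Proof.
  intros Hh. unfold sumA, sumB.
  rewrite <- sumZ_plus by (auto using geo_sech, geo_weighted_sech, sgn_le_1).
  rewrite <- (sumZ_even_odd (fun z => sech (IZR z * h) + sgn z * sech (IZR z * h)))
    by (apply geo_plus; auto using geo_sech, geo_weighted_sech, sgn_le_1).
  replace (sumZ (fun z => sech (IZR z * (2 * h))))
    with (sumZ (fun z => 2 * sech (IZR z * (2 * h))) / 2) by (rewrite sumZ_scal; field).
  f_equal. apply sumZ_ext. intros z.
  rewrite sgn_double, sgn_succ_double, mult_IZR.
  replace (2 * IZR z * h) with (IZR z * (2 * h)) by ring. ring.
Qed.

Lemma sumAB (h : R) : 0 < h ->
  sumA h * sumB h = sumZ (fun z => sgn z * (sech (IZR z * h) * sech (IZR z * h))).
Proof.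
  intros Hh.
  rewrite <- (alternating_product h Hh (fun _ => 1)); [|intros; ring|reflexivity|].
  - unfold sumA, sumB. f_equal; apply sumZ_ext; intros; ring.
  - apply geo_weighted_sech; [assumption|]. intros; rewrite Rabs_R1; lra.
Qed.

(** [sumB (2 * h)] is [D(i)]: the odd powers of [i] cancel in pairs and the even ones
    alternate.  Its square is [D(i) * D(-i)], again an alternating product. *)
Lemma sumB_double (h : R) : 0 < h -> sumB (2 * h) ^ 2 = sumA h * sumB h.
Proof.
  intros Hh. set (a := fun z => sech (IZR z * h)).
  set (fc := fun z => cos_quarter z * a z). set (fs := fun z => sin_quarter z * a z).
  assert (Hc : geo fc) by (apply geo_weighted_sech; [assumption|apply quarter_bound]).
  assert (Hs : geo fs) by (apply geo_weighted_sech; [assumption|apply quarter_bound]).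
  assert (HB : sumB (2 * h) = sumZ fc).
  { rewrite <- (sumZ_even_odd fc Hc). apply sumZ_ext. intros z. unfold fc, a.
    rewrite cos_quarter_double, cos_quarter_succ_double, mult_IZR.
    replace (2 * IZR z * h) with (IZR z * (2 * h)) by ring. ring. }
  assert (H0 : sumZ fs = 0).
  { pose proof (sumZ_opp_arg fs Hs) as H.
    rewrite (sumZ_ext (fun z => fs (- z)%Z) (fun z => -1 * fs z)) in H.
    - rewrite sumZ_scal in H. lra.
    - intros z. unfold fs, a. rewrite sin_quarter_opp, (sech_even h). ring. }
  rewrite sumAB by assumption.
  replace (sumB (2 * h) ^ 2) with (sumZ fc * sumZ fc + sumZ fs * sumZ fs)
    by (rewrite HB, H0; ring).
  rewrite !sumZ_mult by assumption.
  rewrite <- sumZ_plus by (now apply geo_convolution).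
  assert (He : forall n, sumZ (fun j => fc j * fc (n - j)%Z) + sumZ (fun j => fs j * fs (n - j)%Z)
     = cos_quarter n * sgn n * sumZ (fun j => sgn j * (a j * a (n - j)%Z))).
  { intros n. rewrite <- sumZ_scal, <- sumZ_plus by (now apply geo_convolution_term).
    apply sumZ_ext. intros j. unfold fc, fs.
    transitivity ((cos_quarter j * cos_quarter (n - j) + sin_quarter j * sin_quarter (n - j))
       * (a j * a (n - j)%Z)); [ring|].
    rewrite quarter_product. replace (j + (n - j))%Z with n by lia. rewrite sgn_sub. ring. }
  rewrite sumZ_single.
  - rewrite He. change (cos_quarter 0) with 1. change (sgn 0) with 1. rewrite !Rmult_1_l.
    apply sumZ_ext. intros j. simpl Z.sub. unfold a. now rewrite (sech_even h).
  - apply geo_plus; now apply geo_convolution.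
  - intros n Hn. rewrite He. unfold a. rewrite convolution_sgn_sech by assumption. ring.
Qed.

(** * The sums with exponential weights *)

Definition half_weight (h : R) (z : Z) : R := exp (- (IZR z * (h / 2))).

Definition sumU (h : R) : R := sumZ (fun z => half_weight h z * sech (IZR z * h)).
Definition sumV (h : R) : R := sumZ (fun z => sgn z * (half_weight h z * sech (IZR z * h))).

Lemma half_weight_add (h : R) (x y : Z) :
  half_weight h (x + y) = half_weight h x * half_weight h y.
Proof. unfold half_weight. rewrite <- exp_plus, plus_IZR. f_equal. ring. Qed.

Lemma half_weight_0 (h : R) : half_weight h 0 = 1.
Proof. unfold half_weight. rewrite Rmult_0_l, Ropp_0. apply exp_0. Qed.

Lemma half_weight_pos (h : R) (z : Z) : 0 < half_weight h z.
Proof. apply exp_pos. Qed.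

Lemma geo_half_weight_sech (h : R) : 0 < h ->
  geo (fun z => half_weight h z * sech (IZR z * h)).
Proof.
  intros Hh. exists 2, (exp (- (h / 2))). split; [apply exp_neg_bounds; lra|].
  intros z. rewrite Rabs_pos_eq
    by (left; apply Rmult_lt_0_compat; [apply half_weight_pos|apply sech_pos]).
  apply Rle_trans with (exp (Rabs (IZR z) * (h / 2)) * (2 * exp (- (Rabs (IZR z) * h)))).
  - apply Rmult_le_compat.
    + left; apply half_weight_pos.
    + left; apply sech_pos.
    + unfold half_weight.
      assert (Hle : - (IZR z * (h / 2)) <= Rabs (IZR z) * (h / 2)).
      { rewrite Ropp_mult_distr_l. apply Rmult_le_compat_r; [lra|].
        rewrite <- Rabs_Ropp. apply Rle_abs. }
      destruct Hle as [Hlt| ->]; [left; now apply exp_increasing|lra].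
    + rewrite <- (Rabs_pos_eq h) at 2 by lra. rewrite <- Rabs_mult. apply sech_upper.
  - rewrite Rabs_IZR, <- exp_INR_mult.
    apply Req_le. rewrite (Rmult_comm 2), <- Rmult_assoc, <- exp_plus, Rmult_comm.
    do 2 f_equal. field.
Qed.

Lemma geo_double (f : Z -> R) : geo f -> geo (fun z => f (2 * z)%Z).
Proof.
  intros (C & s & Hs & H). exists C, s. split; auto.
  intros z. eapply Rle_trans; [apply H|].
  apply Rmult_le_compat_l; [now apply (geo_const_nonneg f C s)|].
  apply pow_anti; [auto|lia].
Qed.

Lemma sumUV (h : R) : 0 < h -> sumU h * sumV h = sumA h * sumB h.
Proof.
  intros Hh. rewrite sumAB by assumption.
  apply (alternating_product h Hh (half_weight h)).
  - apply half_weight_add.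
  - apply half_weight_0.
  - now apply geo_half_weight_sech.
Qed.

(** The sum of squares keeps the even convolution coefficients
    [c (2 z)], equal to [4 z / sinh (2 z h)] for nonzero [z], with weight [exp (- z h)].
    Symmetrising in [z] replaces the weight by [cosh (z h)], and
    [cosh (z h) * c (2 z) = c z] by the duplication formula, which leaves the coefficients
    of [sumA h ^ 2]. *)
Lemma sumU2V2 (h : R) : 0 < h -> sumU h ^ 2 + sumV h ^ 2 = 2 * sumA h ^ 2.
Proof.
  intros Hh. set (a := fun z => sech (IZR z * h)).
  set (c := fun n => sumZ (fun j => a j * a (n - j)%Z)).
  set (e := half_weight h).
  assert (Hga : geo a) by now apply geo_sech.
  assert (Hgf : geo (fun z => e z * a z)) by now apply geo_half_weight_sech.
  assert (Hgg : geo (fun z => sgn z * (e z * a z)))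
    by (apply geo_bounded_mult with 1; [apply sgn_le_1|assumption]).
  assert (HU : sumU h ^ 2 = sumZ (fun n => e n * c n)).
  { replace (sumU h ^ 2) with (sumU h * sumU h) by ring.
    unfold sumU. rewrite sumZ_mult by assumption. apply sumZ_ext. intros n.
    unfold c. rewrite <- sumZ_scal. apply sumZ_ext. intros j.
    replace (e n) with (e j * e (n - j)%Z)
      by (unfold e; rewrite <- half_weight_add; f_equal; lia).
    unfold e, a. ring. }
  assert (HV : sumV h ^ 2 = sumZ (fun n => sgn n * (e n * c n))).
  { replace (sumV h ^ 2) with (sumV h * sumV h) by ring.
    unfold sumV. rewrite sumZ_mult by assumption. apply sumZ_ext. intros n.
    unfold c. rewrite <- 2!sumZ_scal. apply sumZ_ext. intros j.
    replace (e n) with (e j * e (n - j)%Z)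
      by (unfold e; rewrite <- half_weight_add; f_equal; lia).
    replace (sgn n) with (sgn j * sgn (n - j)) by (rewrite <- sgn_add; f_equal; lia).
    unfold e, a. ring. }
  assert (HA : sumA h ^ 2 = sumZ c).
  { replace (sumA h ^ 2) with (sumA h * sumA h) by ring.
    unfold sumA. rewrite sumZ_mult by assumption. reflexivity. }
  assert (Hec : geo (fun n => e n * c n)).
  { apply geo_ext with (2 := geo_convolution _ _ Hgf Hgf). intros n.
    unfold c. rewrite <- sumZ_scal. apply sumZ_ext. intros j.
    replace (e n) with (e j * e (n - j)%Z)
      by (unfold e; rewrite <- half_weight_add; f_equal; lia). ring. }
  assert (Hsec : geo (fun n => sgn n * (e n * c n)))
    by (apply geo_bounded_mult with 1; [apply sgn_le_1|assumption]).
  rewrite HU, HV, HA, <- sumZ_plus by assumption.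
  rewrite <- (sumZ_even_odd (fun n => e n * c n + sgn n * (e n * c n)))
    by now apply geo_plus.
  rewrite (sumZ_ext _ (fun z => 2 * (e (2 * z)%Z * c (2 * z)%Z)))
    by (intros z; rewrite sgn_double, sgn_succ_double; ring).
  rewrite sumZ_scal. f_equal.
  set (g := fun z => e (2 * z)%Z * c (2 * z)%Z).
  assert (Hg : geo g) by (apply (geo_double (fun n => e n * c n)); assumption).
  transitivity ((sumZ g + sumZ (fun z => g (- z)%Z)) / 2).
  { rewrite sumZ_opp_arg by assumption. field. }
  rewrite <- sumZ_plus by (auto; now apply geo_opp_arg).
  rewrite (sumZ_ext _ (fun z => 2 * c z)); [rewrite sumZ_scal; field|].
  intros z. unfold g.
  destruct (Z.eq_dec z 0) as [->|Hz].
  { simpl. unfold e. rewrite half_weight_0. ring. }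
  unfold c, a. rewrite !convolution_sech by (assumption || lia).
  unfold e, half_weight.
  replace (2 * - z)%Z with (- (2 * z))%Z by lia. rewrite opp_IZR, mult_IZR.
  replace (2 * IZR z * h) with (2 * (IZR z * h)) by ring.
  replace (- (2 * IZR z) * h) with (- (2 * (IZR z * h))) by ring.
  replace (sinh (- (2 * (IZR z * h)))) with (- sinh (2 * (IZR z * h)))
    by (unfold sinh; rewrite Ropp_involutive; field).
  replace (- (2 * IZR z * (h / 2))) with (- (IZR z * h)) by field.
  replace (- (- (2 * IZR z) * (h / 2))) with (IZR z * h) by field.
  set (x := IZR z * h).
  assert (Hx : x <> 0)
    by (unfold x; apply Rmult_integral_contrapositive; split; [now apply not_0_IZR|lra]).
  pose proof (sinh_neq_0 x Hx). pose proof (cosh_pos x).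
  rewrite sinh_double.
  transitivity (2 * (2 * IZR z) * (exp x + exp (- x)) / (2 * sinh x * cosh x)).
  { field. lra. }
  replace (exp x + exp (- x)) with (2 * cosh x) by (unfold cosh; field).
  field. lra.
Qed.

(** * Behaviour of the sums under repeated doubling *)

Lemma weighted_sech_near_1 (h : R) (w : Z -> R) : 0 < h ->
  (forall z, Rabs (w z) <= 1) -> w 0%Z = 1 ->
  Rabs (sumZ (fun z => w z * sech (IZR z * h)) - 1) <= 6 * exp (- h) / (1 - exp (- h)).
Proof.
  intros Hh Hw H0. pose proof (exp_neg_bounds h Hh) as Hr.
  set (r := exp (- h)) in *.
  set (f := fun z => w z * sech (IZR z * h)).
  assert (Hf : geo f) by now apply geo_weighted_sech.
  assert (Hb : forall z, Rabs (f z) <= 2 * r ^ Z.abs_nat z).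
  { intros z. unfold f. rewrite Rabs_mult, (Rabs_pos_eq (sech _)) by (left; apply sech_pos).
    pose proof (sechZ_upper h z Hh) as Hs. fold r in Hs. pose proof (Hw z).
    pose proof (Rabs_pos (w z)). pose proof (sech_pos (IZR z * h)). nra. }
  unfold sumZ. rewrite Series_incr_1 by now apply geo_ex.
  assert (Hs : Rabs (Series (fun k => fold_term f (S k))) <= 4 * r * / (1 - r)).
  { rewrite <- (is_series_unique _ _ (is_series_geom r ltac:(rewrite Rabs_pos_eq; lra))),
      <- Series_scal_l.
    apply Series_bound; [|apply ex_series_geom_scal; lra].
    intros n. eapply Rle_trans; [apply (fold_term_bound f 2 r Hr Hb)|].
    simpl. lra. }
  assert (H1 : Rabs (fold_term f 0 - 1) <= 2 * r).
  { replace (fold_term f 0 - 1) with (f (-1)%Z).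
    - eapply Rle_trans; [apply Hb|]. simpl. lra.
    - unfold fold_term. simpl. unfold f at 2. rewrite H0, Rmult_0_l, sech_0. ring. }
  replace (fold_term f 0 + _ - 1) with
    ((fold_term f 0 - 1) + Series (fun k => fold_term f (S k))) by ring.
  eapply Rle_trans; [apply Rabs_triang|].
  assert (Hi : 1 <= / (1 - r)) by (rewrite <- Rinv_1 at 1; apply Rinv_le_contravar; lra).
  unfold Rdiv. nra.
Qed.

Definition decay (h : R) : R := 6 * exp (- h) / (1 - exp (- h)).

Lemma sumA_near_1 (h : R) : 0 < h -> Rabs (sumA h - 1) <= decay h.
Proof.
  intros Hh. unfold sumA.
  rewrite (sumZ_ext _ (fun z => 1 * sech (IZR z * h))) by (intros; ring).
  apply (weighted_sech_near_1 h (fun _ => 1)); auto.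
  intros; rewrite Rabs_R1; lra.
Qed.

Lemma sumB_near_1 (h : R) : 0 < h -> Rabs (sumB h - 1) <= decay h.
Proof. intros Hh. apply weighted_sech_near_1; auto using sgn_le_1. Qed.

Lemma doubling_seq_lim (h : R) : 0 < h -> is_lim_seq (fun n => 2 ^ n * h) p_infty.
Proof.
  intros Hh. apply is_lim_seq_ext with (fun n => h * 2 ^ n); [intros; ring|].
  replace p_infty with (Rbar_mult h p_infty).
  - apply is_lim_seq_scal_l. apply is_lim_seq_geom_p. lra.
  - simpl. destruct (Rle_dec 0 h) as [H|H]; [|lra].
    destruct (Rle_lt_or_eq_dec 0 h H); [reflexivity|lra].
Qed.

Lemma doubling_pos (h : R) (n : nat) : 0 < h -> 0 < 2 ^ n * h.
Proof. intros Hh. apply Rmult_lt_0_compat; [apply pow_lt; lra|assumption]. Qed.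

Lemma exp_doubling_lim (h : R) : 0 < h -> is_lim_seq (fun n => exp (- (2 ^ n * h))) 0.
Proof.
  intros Hh. apply (is_lim_comp_seq exp (fun n => - (2 ^ n * h)) m_infty 0).
  - apply is_lim_exp_m.
  - exists 0%nat. intros n _. discriminate.
  - apply (is_lim_seq_opp (fun n => 2 ^ n * h) p_infty). now apply doubling_seq_lim.
Qed.

Lemma decay_lim (h : R) : 0 < h -> is_lim_seq (fun n => decay (2 ^ n * h)) 0.
Proof.
  intros Hh. replace (Finite 0) with (Finite (6 * 0 / (1 - 0))) by (f_equal; field).
  unfold decay. pose proof (exp_doubling_lim h Hh) as He.
  apply is_lim_seq_div'; [| |lra].
  - apply is_lim_seq_mult'; [apply is_lim_seq_const|exact He].
  - apply is_lim_seq_minus'; [apply is_lim_seq_const|exact He].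
Qed.

Lemma is_lim_seq_near (u g : nat -> R) (l : R) :
  (forall n, Rabs (u n - l) <= g n) -> is_lim_seq g 0 -> is_lim_seq u l.
Proof.
  intros Hug Hg.
  apply is_lim_seq_le_le with (u := fun n => l - g n) (w := fun n => l + g n).
  - intros n. specialize (Hug n). apply Rabs_le_between' in Hug. lra.
  - replace (Finite l) with (Finite (l - 0)) by (f_equal; ring).
    apply is_lim_seq_minus'; [apply is_lim_seq_const|exact Hg].
  - replace (Finite l) with (Finite (l + 0)) by (f_equal; ring).
    apply is_lim_seq_plus'; [apply is_lim_seq_const|exact Hg].
Qed.

Lemma sumA_lim (h : R) : 0 < h -> is_lim_seq (fun n => sumA (2 ^ n * h)) 1.
Proof.
  intros Hh. apply is_lim_seq_near with (fun n => decay (2 ^ n * h)).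
  - intros n. now apply sumA_near_1, doubling_pos.
  - now apply decay_lim.
Qed.

Lemma sumB_lim (h : R) : 0 < h -> is_lim_seq (fun n => sumB (2 ^ n * h)) 1.
Proof.
  intros Hh. apply is_lim_seq_near with (fun n => decay (2 ^ n * h)).
  - intros n. now apply sumB_near_1, doubling_pos.
  - now apply decay_lim.
Qed.

Lemma sumA_minus_sumB_lower (h : R) : 0 < h -> 2 * exp (- h) <= sumA h - sumB h.
Proof.
  intros Hh. unfold sumA, sumB.
  rewrite <- sumZ_minus by (auto using geo_sech, geo_weighted_sech, sgn_le_1).
  set (f := fun z => (1 - sgn z) * sech (IZR z * h)).
  rewrite (sumZ_ext _ f) by (intros; unfold f; ring).
  assert (Hf0 : forall z, 0 <= f z).
  { intros z. unfold f. pose proof (sgn_le_1 z) as H. apply Rabs_le_between in H.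
    pose proof (sech_pos (IZR z * h)). nra. }
  assert (Hf : geo f).
  { apply geo_ext with (fun z => sech (IZR z * h) + -1 * (sgn z * sech (IZR z * h))).
    - intros; unfold f; ring.
    - apply geo_plus; [|apply geo_scal];
      auto using geo_sech, geo_weighted_sech, sgn_le_1. }
  pose proof (sumZ_ge_term f 1 Hf Hf0) as H.
  pose proof (Hf0 (-1 - Z.of_nat 1)%Z).
  assert (Hv : f (Z.of_nat 1) = 2 * sech h).
  { unfold f. change (sgn (Z.of_nat 1)) with (-1). simpl IZR. rewrite Rmult_1_l. ring. }
  pose proof (sech_lower h ltac:(lra)). lra.
Qed.

Lemma sumA_minus_sumB_upper (h : R) : 0 < h -> sumA h - sumB h <= 2 * decay h.
Proof.
  intros Hh. pose proof (sumA_near_1 h Hh) as H1. pose proof (sumB_near_1 h Hh) as H2.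
  apply Rabs_le_between' in H1. apply Rabs_le_between' in H2. lra.
Qed.

Lemma sumA_ge_1 (h : R) : 0 < h -> 1 <= sumA h.
Proof.
  intros Hh.
  pose proof (sumZ_ge_term _ 0 (geo_sech h Hh) (fun z => Rlt_le _ _ (sech_pos _))) as H.
  simpl in H. rewrite Rmult_0_l, sech_0 in H. pose proof (sech_pos (-1 * h)).
  unfold sumA. lra.
Qed.

(** Positivity holds for [2 ^ n * h] with [n] large, since the limit is [1], and descends
    because [sumA h * sumB h] is the square of [sumB (2 * h)]. *)
Lemma sumB_pos (h : R) : 0 < h -> 0 < sumB h.
Proof.
  intros Hh.
  assert (Hex : exists n, 0 < sumB (2 ^ n * h)).
  { pose proof (sumB_lim h Hh) as Hl.
    apply is_lim_seq_spec in Hl. destruct (Hl (mkposreal (1/2) ltac:(lra))) as [N HN].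
    exists N. specialize (HN N (le_n N)). simpl in HN.
    apply Rabs_def2 in HN. lra. }
  destruct Hex as [n Hn]. revert h Hh Hn.
  induction n as [|n IH]; intros h Hh Hn.
  - simpl in Hn. now rewrite Rmult_1_l in Hn.
  - assert (H2 : 0 < sumB (2 * h)).
    { apply IH; [lra|]. replace (2 ^ n * (2 * h)) with (2 ^ S n * h) by (simpl; ring). assumption. }
    pose proof (sumB_double h Hh). pose proof (sumA_ge_1 h Hh).
    assert (0 < sumB (2 * h) ^ 2) by (apply pow_lt; assumption). nra.
Qed.

Lemma sumB_lt_sumA (h : R) : 0 < h -> sumB h < sumA h.
Proof.
  intros Hh. pose proof (sumA_minus_sumB_lower h Hh). pose proof (exp_pos (- h)). lra.
Qed.

Lemma sumB_double_sqrt (h : R) : 0 < h -> sumB (2 * h) = sqrt (sumA h * sumB h).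
Proof.
  intros Hh. rewrite <- sumB_double by assumption. symmetry. apply sqrt_pow2.
  left. apply sumB_pos; lra.
Qed.

Lemma sumU_ge_sumV (h : R) : 0 < h -> sumV h <= sumU h.
Proof.
  intros Hh. apply Rminus_le_0. unfold sumU, sumV.
  assert (Hg := geo_half_weight_sech h Hh).
  rewrite <- sumZ_minus
    by (auto; (apply geo_bounded_mult with 1; [apply sgn_le_1|assumption])).
  set (f := fun z => (1 - sgn z) * (half_weight h z * sech (IZR z * h))).
  rewrite (sumZ_ext _ f) by (intros; unfold f; ring).
  assert (Hf0 : forall z, 0 <= f z).
  { intros z. unfold f. pose proof (sgn_le_1 z) as H. apply Rabs_le_between in H.
    apply Rmult_le_pos; [lra|].
    left; apply Rmult_lt_0_compat; [apply half_weight_pos|apply sech_pos]. }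
  assert (Hf : geo f).
  { apply geo_bounded_mult with 2; [|assumption].
    intros z. pose proof (sgn_le_1 z) as H. apply Rabs_le_between in H.
    apply Rabs_le. lra. }
  pose proof (sumZ_ge_term f 0 Hf Hf0).
  pose proof (Hf0 (Z.of_nat 0)). pose proof (Hf0 (-1 - Z.of_nat 0)%Z). lra.
Qed.

Lemma sumU_pos (h : R) : 0 < h -> 0 < sumU h.
Proof.
  intros Hh.
  assert (Hp : forall z, 0 < half_weight h z * sech (IZR z * h))
    by (intros; apply Rmult_lt_0_compat; [apply half_weight_pos|apply sech_pos]).
  pose proof (sumZ_ge_term _ 0 (geo_half_weight_sech h Hh) (fun z => Rlt_le _ _ (Hp z))) as H.
  cbv beta in H. pose proof (Hp (Z.of_nat 0)). pose proof (Hp (-1 - Z.of_nat 0)%Z).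
  unfold sumU. lra.
Qed.

(** From [U V] and [U^2 + V^2] at [2 h], the number [V^2] is a root of a quadratic whose
    roots are [A(2h) * B(h)] and [A(2h) * A(h)]; [V <= U] selects the smaller one. *)
Lemma sumV_double (h : R) : 0 < h ->
  0 < sumV (2 * h) /\ sumV (2 * h) ^ 2 = sumB h * (sumA h + sumB h) / 2.
Proof.
  intros Hh. assert (Hh2 : 0 < 2 * h) by lra.
  pose proof (sumUV (2 * h) Hh2) as H1. pose proof (sumU2V2 (2 * h) Hh2) as H2.
  pose proof (sumU_pos _ Hh2) as HU. pose proof (sumU_ge_sumV _ Hh2) as HUV.
  pose proof (sumB_pos h Hh) as HB. pose proof (sumB_lt_sumA h Hh) as HBA.
  pose proof (sumB_pos _ Hh2) as HB2. pose proof (sumB_double h Hh) as HBd.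
  pose proof (sumA_double h Hh) as HAd.
  set (U := sumU (2 * h)) in *. set (V := sumV (2 * h)) in *.
  set (A2 := sumA (2 * h)) in *. set (B2 := sumB (2 * h)) in *.
  set (A := sumA h) in *. set (B := sumB h) in *.
  assert (HV : 0 < V).
  { apply Rmult_lt_reg_l with U; [assumption|]. rewrite Rmult_0_r, H1. nra. }
  split; [assumption|].
  assert (HUV2 : U ^ 2 * V ^ 2 = A2 ^ 2 * (A * B)).
  { rewrite <- HBd. replace (U ^ 2 * V ^ 2) with ((U * V) ^ 2) by ring. rewrite H1. ring. }
  assert (HVU2 : V ^ 2 <= U ^ 2) by (apply pow_incr; lra).
  assert (Hroot : (V ^ 2 - A2 * B) * (V ^ 2 - A2 * A) = 0).
  { replace (U ^ 2) with (2 * A2 ^ 2 - V ^ 2) in HUV2 by lra.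
    assert (A = 2 * A2 - B) by lra. subst A. rewrite H in *. nra. }
  apply Rmult_integral in Hroot.
  assert (HAB : A + B = 2 * A2) by lra.
  destruct Hroot as [Hr|Hr]; [nra|].
  assert (A2 * A <= A2 * B) by nra. assert (0 < A2) by lra. nra.
Qed.

(** * Gauss's transformation *)

Definition gauss_quad (a b t : R) : R := a ^ 2 * cos t ^ 2 + b ^ 2 * sin t ^ 2.
Definition gauss_I (a b : R) : R := RInt (fun t => / sqrt (gauss_quad a b t)) 0 (PI / 2).

Lemma cos2_sin2 (t : R) : cos t ^ 2 = 1 - sin t ^ 2.
Proof. pose proof (sin2_cos2 t) as H. unfold Rsqr in H. nra. Qed.

Lemma convex_pos (x a b : R) : 0 <= x <= 1 -> 0 < a -> 0 < b -> 0 < a * (1 - x) + b * x.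
Proof. intros Hx Ha Hb. destruct (Rle_dec x (1 / 2)); nra. Qed.

Lemma sin2_bounds (t : R) : 0 <= sin t ^ 2 <= 1.
Proof.
  pose proof (pow2_ge_0 (sin t)). pose proof (pow2_ge_0 (cos t)) as H2.
  rewrite cos2_sin2 in H2. lra.
Qed.

Lemma gauss_quad_pos (a b t : R) : 0 < a -> 0 < b -> 0 < gauss_quad a b t.
Proof.
  intros Ha Hb. unfold gauss_quad. rewrite cos2_sin2.
  apply convex_pos; [apply sin2_bounds|now apply pow_lt|now apply pow_lt].
Qed.

Lemma gauss_integrand_continuous (a b t : R) : 0 < a -> 0 < b ->
  continuous (fun t => / sqrt (gauss_quad a b t)) t.
Proof.
  intros Ha Hb. apply (ex_derive_continuous (K := R_AbsRing) (V := R_NormedModule)).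
  pose proof (gauss_quad_pos a b t Ha Hb) as Hq. unfold gauss_quad in *.
  pose proof (sqrt_lt_R0 _ Hq). auto_derive. simpl in *. repeat split; lra.
Qed.

Lemma ex_RInt_cont (f : R -> R) (a b : R) : (forall t, continuous f t) -> ex_RInt f a b.
Proof. intros Hf. apply (ex_RInt_continuous (V := R_CompleteNormedModule)). auto. Qed.

Lemma RInt_scal_R (f : R -> R) (k a b : R) :
  ex_RInt f a b -> RInt (fun t => k * f t) a b = k * RInt f a b.
Proof. exact (RInt_scal (V := R_CompleteNormedModule) f a b k). Qed.

Lemma gauss_I_scal (c a b : R) : 0 < c -> 0 < a -> 0 < b ->
  gauss_I (c * a) (c * b) = gauss_I a b / c.
Proof.
  intros Hc Ha Hb. replace (gauss_I a b / c) with (/ c * gauss_I a b) by (unfold Rdiv; ring).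
  unfold gauss_I.
  rewrite <- (RInt_scal_R (fun t => / sqrt (gauss_quad a b t)))
    by (apply ex_RInt_cont; intros; now apply gauss_integrand_continuous).
  apply RInt_ext. intros t _. unfold scal; simpl; unfold mult; simpl.
  replace (gauss_quad (c * a) (c * b) t) with (c ^ 2 * gauss_quad a b t)
    by (unfold gauss_quad; ring).
  pose proof (gauss_quad_pos a b t Ha Hb).
  rewrite sqrt_mult by (try apply pow2_ge_0; lra). rewrite sqrt_pow2 by lra.
  apply Rinv_mult.
Qed.

Lemma gauss_I_half_period (a b : R) : 0 < a -> 0 < b ->
  RInt (fun t => / sqrt (gauss_quad a b t)) 0 PI = 2 * gauss_I a b.
Proof.
  intros Ha Hb. set (f := fun t => / sqrt (gauss_quad a b t)).
  assert (Hc : forall t, continuous f t) by (intros; now apply gauss_integrand_continuous).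
  rewrite <- (RInt_Chasles f 0 (PI / 2) PI) by now apply ex_RInt_cont.
  assert (H : RInt f (PI / 2) PI = RInt f 0 (PI / 2)).
  { pose proof (RInt_comp (V := R_CompleteNormedModule) f (fun t => PI - t) (fun _ => -1)
                 (PI / 2) 0) as H.
    cbv beta in H. replace (PI - PI / 2) with (PI / 2) in H by field. rewrite Rminus_0_r in H.
    rewrite <- H.
    - assert (Hc' : forall t, continuous (fun t => -1 * f (PI - t)) t).
      { intros t. apply (continuous_scal_r (K := R_AbsRing) (V := R_NormedModule) (-1)
                 (fun t => f (PI - t))).
        apply (continuous_comp (fun t => PI - t) f); [|apply Hc].
        apply (ex_derive_continuous (K := R_AbsRing) (V := R_NormedModule)).
        auto_derive; trivial. }
      rewrite <- (opp_RInt_swap (V := R_CompleteNormedModule))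
        by (apply (ex_RInt_cont (fun t => -1 * f (PI - t))); exact Hc').
      rewrite <- (RInt_opp (V := R_CompleteNormedModule))
        by (apply (ex_RInt_cont (fun t => -1 * f (PI - t))); exact Hc').
      apply RInt_ext. intros t _. unfold f, opp, scal; simpl; unfold mult; simpl.
      replace (gauss_quad a b (PI - t)) with (gauss_quad a b t); [ring|].
      unfold gauss_quad. rewrite sin_PI_x.
      replace (cos (PI - t)) with (- cos t); [ring|].
      unfold Rminus. rewrite cos_plus, cos_PI, sin_PI, cos_neg. ring.
    - intros; apply Hc.
    - intros t _. split; [auto_derive; trivial; ring|apply continuous_const]. }
  rewrite H. unfold gauss_I. fold f. unfold plus; simpl. ring.
Qed.

(** Landen's substitution sends [t] to [t + s] with [tan s = (b / a) * tan t].  Writing it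
    as [2 * t - atan (N / M)] keeps it smooth at [t = PI / 2], where it takes the value
    [PI]. *)
Section Landen.
Variables a b : R.
Hypothesis Ha : 0 < a.
Hypothesis Hb : 0 < b.

Let M t := a * cos t ^ 2 + b * sin t ^ 2.
Let N t := (a - b) * sin t * cos t.
Let phi t := 2 * t - atan (N t / M t).

Lemma landen_M_pos t : 0 < M t.
Proof.
  unfold M. rewrite cos2_sin2. apply convex_pos; [apply sin2_bounds|apply Ha|apply Hb].
Qed.

Lemma landen_norm t : M t ^ 2 + N t ^ 2 = gauss_quad a b t.
Proof.
  unfold M, N, gauss_quad. pose proof (cos2_sin2 t) as H. ring [H].
Qed.

Lemma landen_derive t : is_derive phi t ((a + b) * M t / gauss_quad a b t).
Proof.
  pose proof (landen_M_pos t) as HM. pose proof (landen_norm t) as Hn.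
  pose proof (gauss_quad_pos a b t Ha Hb) as Hq.
  unfold phi, N, M in *. auto_derive.
  - simpl in *. lra.
  - rewrite <- Hn in *. pose proof (cos2_sin2 t) as H.
    set (s := sin t) in *. set (c := cos t) in *. simpl in *.
    assert (Hx : a * (c * (c * 1)) + b * (s * (s * 1)) <> 0) by lra.
    field_simplify_eq.
    + ring [H].
    + repeat split; try (simpl; lra).
      all: try (intros H0; apply Rlt_irrefl with 0; rewrite <- H0 at 2; nra).
Qed.

Lemma landen_sin t : sin (phi t) = (a + b) * sin t * cos t / sqrt (gauss_quad a b t).
Proof.
  pose proof (landen_M_pos t) as HM. pose proof (landen_norm t) as Hn.
  pose proof (gauss_quad_pos a b t Ha Hb) as Hq. pose proof (sqrt_lt_R0 _ Hq) as Hs.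
  assert (Hr : sqrt (1 + (N t / M t)²) = sqrt (gauss_quad a b t) / M t).
  { rewrite <- (sqrt_pow2 (M t)) at 2 by lra. rewrite <- sqrt_div by (try apply pow_lt; lra).
    f_equal. rewrite <- Hn. unfold Rsqr. field. lra. }
  unfold phi. rewrite sin_minus, sin_atan, cos_atan, Hr, sin_2a, cos_2a.
  pose proof (cos2_sin2 t) as H.
  transitivity ((2 * sin t * cos t * M t - (cos t * cos t - sin t * sin t) * N t)
     / sqrt (gauss_quad a b t)).
  { field. lra. }
  f_equal. unfold M, N. ring [H].
Qed.

Lemma landen_quad t :
  gauss_quad ((a + b) / 2) (sqrt (a * b)) (phi t)
  = ((a + b) * M t / (2 * sqrt (gauss_quad a b t))) ^ 2.
Proof.
  pose proof (gauss_quad_pos a b t Ha Hb) as Hq. pose proof (sqrt_lt_R0 _ Hq) as Hs.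
  unfold gauss_quad at 1. rewrite cos2_sin2, landen_sin.
  rewrite pow2_sqrt by nra.
  pose proof (pow2_sqrt (gauss_quad a b t) ltac:(lra)) as H2.
  pose proof (cos2_sin2 t) as H.
  transitivity (((a + b) / 2) ^ 2 * (gauss_quad a b t - (a - b) ^ 2 * (sin t * cos t) ^ 2)
     / sqrt (gauss_quad a b t) ^ 2).
  - set (r := sqrt (gauss_quad a b t)) in *. rewrite <- H2. field. lra.
  - replace (gauss_quad a b t - (a - b) ^ 2 * (sin t * cos t) ^ 2) with (M t ^ 2).
    + field. lra.
    + rewrite <- landen_norm. unfold N. ring.
Qed.

Lemma gauss_I_agm : gauss_I a b = gauss_I ((a + b) / 2) (sqrt (a * b)).
Proof.
  assert (Ha1 : 0 < (a + b) / 2) by lra.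
  assert (Hb1 : 0 < sqrt (a * b)) by (apply sqrt_lt_R0; nra).
  set (f := fun t => / sqrt (gauss_quad ((a + b) / 2) (sqrt (a * b)) t)).
  assert (Hc : forall t, continuous f t) by (intros; now apply gauss_integrand_continuous).
  pose proof (RInt_comp (V := R_CompleteNormedModule) f phi
     (fun t => (a + b) * M t / gauss_quad a b t) 0 (PI / 2)) as H.
  assert (H0 : phi 0 = 0).
  { unfold phi. replace (N 0 / M 0) with 0 by (unfold N; rewrite sin_0; unfold Rdiv; ring).
    rewrite atan_0. ring. }
  assert (H1 : phi (PI / 2) = PI).
  { unfold phi. replace (N (PI / 2) / M (PI / 2)) with 0
      by (unfold N; rewrite cos_PI2; unfold Rdiv; ring).
    rewrite atan_0. field. }
  rewrite H0, H1 in H.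
  apply Rmult_eq_reg_l with 2; [|lra].
  rewrite <- (gauss_I_half_period _ _ Ha1 Hb1). fold f. rewrite <- H.
  - unfold gauss_I.
    rewrite <- (RInt_scal_R (fun t => / sqrt (gauss_quad a b t)))
      by (apply ex_RInt_cont; intros; now apply gauss_integrand_continuous).
    apply RInt_ext. intros t _. unfold scal; simpl; unfold mult; simpl.
    unfold f. rewrite landen_quad.
    pose proof (landen_M_pos t). pose proof (gauss_quad_pos a b t Ha Hb) as Hq.
    pose proof (sqrt_lt_R0 _ Hq) as Hs.
    rewrite sqrt_pow2.
    + rewrite <- (sqrt_sqrt (gauss_quad a b t)) at 2 by lra. field. lra.
    + left. apply Rdiv_lt_0_compat; nra.
  - intros; apply Hc.
  - intros t _. split; [apply landen_derive|].
    apply (ex_derive_continuous (K := R_AbsRing) (V := R_NormedModule)).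
    pose proof (gauss_quad_pos a b t Ha Hb) as Hq. unfold gauss_quad in *.
    unfold M. auto_derive. simpl in *. lra.
Qed.

End Landen.

Lemma gauss_I_bounds (a b : R) : 0 < b <= a ->
  PI / 2 / a <= gauss_I a b <= PI / 2 / b.
Proof.
  intros Hab. pose proof PI_RGT_0.
  assert (Hq : forall t, b ^ 2 <= gauss_quad a b t <= a ^ 2).
  { intros t. unfold gauss_quad. rewrite cos2_sin2.
    assert (b ^ 2 <= a ^ 2) by (apply pow_incr; lra).
    pose proof (sin2_bounds t). nra. }
  assert (Hi : forall t, / a <= / sqrt (gauss_quad a b t) <= / b).
  { intros t. specialize (Hq t).
    assert (b <= sqrt (gauss_quad a b t)).
    { apply Rle_trans with (sqrt (b ^ 2)); [rewrite sqrt_pow2; lra|now apply sqrt_le_1_alt]. }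
    assert (sqrt (gauss_quad a b t) <= a).
    { apply Rle_trans with (sqrt (a ^ 2)); [now apply sqrt_le_1_alt|rewrite sqrt_pow2; lra]. }
    split; apply Rinv_le_contravar; lra. }
  assert (Hc : forall c, RInt (fun _ => c) 0 (PI / 2) = PI / 2 * c).
  { intros c. rewrite RInt_const. unfold scal; simpl; unfold mult; simpl. ring. }
  change (PI / 2 * / a <= gauss_I a b <= PI / 2 * / b). rewrite <- !Hc.
  assert (He : ex_RInt (fun t => / sqrt (gauss_quad a b t)) 0 (PI / 2)).
  { apply ex_RInt_cont; intros; apply gauss_integrand_continuous; lra. }
  split; apply RInt_le; try lra; try exact He; try apply ex_RInt_const; intros; apply Hi.
Qed.

(** With [al^2 = a^2 - c^2] the quadratic form is [al^2 cos^2 + c^2], so the integrand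
    times [sin t] has an elementary primitive; the rest [(1 - sin t) / sqrt _] is at most
    [1 / al], because [1 - sin t <= cos t]. *)
Lemma gauss_I_log_bounds (a c al : R) : 0 < c -> 0 < al -> 0 < a -> al ^ 2 = a ^ 2 - c ^ 2 ->
  (ln (al + a) - ln c) / al <= gauss_I a c <= (ln (al + a) - ln c + PI / 2) / al.
Proof.
  intros Hc Hal Ha Heq. pose proof PI_RGT_0.
  set (q := fun t => al ^ 2 * cos t ^ 2 + c ^ 2).
  assert (Hq : forall t, gauss_quad a c t = q t).
  { intros t. unfold gauss_quad, q. rewrite Heq, cos2_sin2. ring. }
  assert (Hq0 : forall t, 0 < q t) by (intros; rewrite <- Hq; now apply gauss_quad_pos).
  set (G := fun t => - ln (al * cos t + sqrt (q t)) / al).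
  set (g := fun t => sin t / sqrt (q t)).
  assert (Hsq : forall t, Rabs (al * cos t) < sqrt (q t)).
  { intros t. rewrite <- sqrt_Rsqr_abs. apply sqrt_lt_1_alt. split; [apply Rle_0_sqr|].
    unfold q, Rsqr. assert (0 < c ^ 2) by (apply pow_lt; assumption). nra. }
  assert (HGd : forall t, is_derive G t (g t)).
  { intros t. pose proof (Hq0 t) as Hp. pose proof (Hsq t) as Hs.
    apply Rabs_def2 in Hs. unfold G, g, q in *. auto_derive.
    - simpl in *. repeat split; lra.
    - simpl in *. field. repeat split; lra. }
  assert (Hgc : forall t, continuous g t).
  { intros t. pose proof (Hq0 t) as Hp. pose proof (sqrt_lt_R0 _ Hp).
    apply (ex_derive_continuous (K := R_AbsRing) (V := R_NormedModule)).
    unfold g, q in *. auto_derive. simpl in *. repeat split; lra. }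
  assert (Hg : RInt g 0 (PI / 2) = (ln (al + a) - ln c) / al).
  { rewrite (is_RInt_unique _ _ _ _ (is_RInt_derive G g 0 (PI / 2)
       (fun t _ => HGd t) (fun t _ => Hgc t))).
    unfold minus, plus, opp; simpl. unfold G, q.
    rewrite cos_PI2, cos_0.
    replace (al ^ 2 * 0 ^ 2 + c ^ 2) with (c ^ 2) by ring.
    replace (al ^ 2 * 1 ^ 2 + c ^ 2) with (a ^ 2) by (rewrite Heq; ring).
    rewrite !sqrt_pow2, Rmult_0_r, Rplus_0_l, Rmult_1_r by lra. field. lra. }
  assert (Hec : forall t, continuous (fun t => / sqrt (gauss_quad a c t)) t)
    by (intros; now apply gauss_integrand_continuous).
  assert (Hpt : forall t, 0 < t < PI / 2 ->
    g t <= / sqrt (gauss_quad a c t) <= g t + / al).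
  { intros t Ht. rewrite Hq. unfold g.
    pose proof (sqrt_lt_R0 _ (Hq0 t)) as Hs. pose proof (Hsq t) as Hab.
    assert (Hcos : 0 < cos t) by (apply cos_gt_0; lra).
    assert (Hsin : 0 < sin t) by (apply sin_gt_0; lra).
    pose proof (cos2_sin2 t) as Hcs. rewrite Rabs_pos_eq in Hab by nra.
    assert (Hone : 1 - sin t <= cos t) by nra.
    split.
    - unfold Rdiv. rewrite <- (Rmult_1_l (/ sqrt _)) at 2.
      apply Rmult_le_compat_r; [left; now apply Rinv_0_lt_compat|nra].
    - apply Rmult_le_reg_r with (sqrt (q t) * al); [nra|].
      replace (/ sqrt (q t) * (sqrt (q t) * al)) with al by (field; lra).
      replace ((sin t / sqrt (q t) + / al) * (sqrt (q t) * al))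
        with (sin t * al + sqrt (q t)) by (field; lra). nra. }
  split.
  - rewrite <- Hg. unfold gauss_I. apply RInt_le; [lra| | |].
    + now apply ex_RInt_cont.
    + now apply ex_RInt_cont.
    + intros; now apply Hpt.
  - replace ((ln (al + a) - ln c + PI / 2) / al) with (RInt (fun t => g t + / al) 0 (PI / 2)).
    + unfold gauss_I. apply RInt_le; [lra| | |].
      * now apply ex_RInt_cont.
      * apply (ex_RInt_plus (V := R_NormedModule) g (fun _ => / al)).
        -- now apply ex_RInt_cont.
        -- apply ex_RInt_const.
      * intros; now apply Hpt.
    + rewrite (RInt_plus (V := R_CompleteNormedModule) g (fun _ => / al)).
      * rewrite Hg, RInt_const. unfold plus, scal; simpl; unfold mult; simpl. field. lra.
      * now apply ex_RInt_cont.
      * apply ex_RInt_const.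
Qed.

(** * The mean iteration evaluated *)

(** The third side of the mean iteration: [sumC h = k * sumA h]. *)
Definition sumC (h : R) : R := sqrt (sumA h ^ 2 - sumB h ^ 2).

Lemma sumC_sqr (h : R) : 0 < h -> 0 < sumC h /\ sumC h ^ 2 = sumA h ^ 2 - sumB h ^ 2.
Proof.
  intros Hh. pose proof (sumB_pos h Hh). pose proof (sumB_lt_sumA h Hh).
  assert (0 < sumA h ^ 2 - sumB h ^ 2) by nra.
  unfold sumC. split; [now apply sqrt_lt_R0|]. rewrite pow2_sqrt; lra.
Qed.

Lemma sumC_double (h : R) : 0 < h -> sumC (2 * h) = (sumA h - sumB h) / 2.
Proof.
  intros Hh. pose proof (sumB_lt_sumA h Hh). unfold sumC.
  rewrite sumA_double, sumB_double by assumption.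
  replace (((sumA h + sumB h) / 2) ^ 2 - sumA h * sumB h)
    with (((sumA h - sumB h) / 2) ^ 2) by field.
  apply sqrt_pow2. lra.
Qed.

Lemma gauss_I_AB_double (h : R) : 0 < h ->
  gauss_I (sumA (2 * h)) (sumB (2 * h)) = gauss_I (sumA h) (sumB h).
Proof.
  intros Hh. pose proof (sumB_pos h Hh). pose proof (sumB_lt_sumA h Hh).
  rewrite sumA_double, sumB_double_sqrt by assumption.
  symmetry. apply gauss_I_agm; lra.
Qed.

(** [A(h)] and [C(h)] are twice the arithmetic and twice the geometric mean of [A(2h)] and
    [C(2h)]: the mean iteration runs in the opposite direction on this pair. *)
Lemma gauss_I_AC_double (h : R) : 0 < h ->
  gauss_I (sumA (2 * h)) (sumC (2 * h)) = 2 * gauss_I (sumA h) (sumC h).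
Proof.
  intros Hh. pose proof (sumB_pos h Hh). pose proof (sumB_lt_sumA h Hh).
  destruct (sumC_sqr h Hh) as [HC HC2].
  rewrite sumA_double, sumC_double by assumption.
  set (p := (sumA h + sumB h) / 2). set (q := (sumA h - sumB h) / 2).
  assert (Hp : 0 < p) by (unfold p; lra). assert (Hq : 0 < q) by (unfold q; lra).
  rewrite gauss_I_agm by assumption.
  replace (sumA h) with (2 * ((p + q) / 2)) by (unfold p, q; field).
  replace (sumC h) with (2 * sqrt (p * q)).
  - rewrite gauss_I_scal; [field|lra|lra|apply sqrt_lt_R0; nra].
  - apply (f_equal sqrt) in HC2. rewrite sqrt_pow2 in HC2 by lra. rewrite HC2.
    replace (sumA h ^ 2 - sumB h ^ 2) with (2 ^ 2 * (p * q)) by (unfold p, q; field).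
    rewrite (sqrt_mult (2 ^ 2) (p * q)) by nra. rewrite sqrt_pow2; lra.
Qed.

Lemma doubling_invariant_value (f : R -> R) (h l : R) :
  (forall h, 0 < h -> f (2 * h) = f h) -> 0 < h ->
  is_lim_seq (fun n => f (2 * (2 ^ n * h))) l -> f h = l.
Proof.
  intros Hf Hh Hl.
  assert (Hn : forall n, f (2 ^ n * h) = f h).
  { induction n as [|n IH]; [simpl; f_equal; ring|].
    rewrite <- IH, <- (Hf (2 ^ n * h)) by now apply doubling_pos.
    f_equal. simpl. ring. }
  assert (Hc : is_lim_seq (fun _ => f h) l).
  { apply is_lim_seq_ext with (2 := Hl). intros n.
    rewrite Hf by now apply doubling_pos. apply Hn. }
  apply is_lim_seq_unique in Hc. rewrite Lim_seq_const in Hc. now inversion Hc.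
Qed.

Lemma sumB_double_lim (h : R) : 0 < h -> is_lim_seq (fun n => sumB (2 * (2 ^ n * h))) 1.
Proof.
  intros Hh. apply is_lim_seq_ext with (fun n => sumB (2 ^ n * (2 * h))).
  - intros n. f_equal. ring.
  - apply sumB_lim. lra.
Qed.

Lemma sumA_double_lim (h : R) : 0 < h -> is_lim_seq (fun n => sumA (2 * (2 ^ n * h))) 1.
Proof.
  intros Hh. apply is_lim_seq_ext with (fun n => sumA (2 ^ n * (2 * h))).
  - intros n. f_equal. ring.
  - apply sumA_lim. lra.
Qed.

Lemma gauss_I_AB (h : R) : 0 < h -> gauss_I (sumA h) (sumB h) = PI / 2.
Proof.
  intros Hh.
  apply (doubling_invariant_value (fun h => gauss_I (sumA h) (sumB h))); auto.
  { intros; now apply gauss_I_AB_double. }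
  apply is_lim_seq_le_le with (u := fun n => PI / 2 / sumA (2 * (2 ^ n * h)))
    (w := fun n => PI / 2 / sumB (2 * (2 ^ n * h))).
  - intros n. pose proof (doubling_pos h n Hh) as Hp.
    assert (Hp2 : 0 < 2 * (2 ^ n * h)) by lra.
    pose proof (sumB_pos _ Hp2). pose proof (sumB_lt_sumA _ Hp2).
    apply gauss_I_bounds. lra.
  - replace (Finite (PI / 2)) with (Finite (PI / 2 / 1)) by (f_equal; field).
    apply is_lim_seq_div'; [apply is_lim_seq_const|now apply sumA_double_lim|lra].
  - replace (Finite (PI / 2)) with (Finite (PI / 2 / 1)) by (f_equal; field).
    apply is_lim_seq_div'; [apply is_lim_seq_const|now apply sumB_double_lim|lra].
Qed.

Lemma ln_sumC_double (h : R) : 0 < h ->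
  - h <= ln (sumC (2 * h)) <= ln 6 - ln (1 - exp (- h)) - h.
Proof.
  intros Hh. rewrite sumC_double by assumption.
  pose proof (sumA_minus_sumB_lower h Hh) as Hl. pose proof (sumA_minus_sumB_upper h Hh) as Hu.
  pose proof (exp_neg_bounds h Hh) as He.
  split.
  - rewrite <- (ln_exp (- h)) at 1. apply ln_le; lra.
  - apply Rle_trans with (ln (decay h)); [apply ln_le; lra|].
    unfold decay. rewrite ln_div, ln_mult, ln_exp by lra. lra.
Qed.

(** [gauss_I A C / h] is invariant under doubling of [h], and the logarithmic bounds with
    [al = B] and [ln C(2h) = - h + O(1)] give its limit. *)
Lemma gauss_I_AC (h : R) : 0 < h -> gauss_I (sumA h) (sumC h) = h / 2.
Proof.
  intros Hh.
  assert (H : gauss_I (sumA h) (sumC h) / h = 1 / 2).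
  2:{ replace (gauss_I (sumA h) (sumC h)) with (gauss_I (sumA h) (sumC h) / h * h)
        by (field; lra). rewrite H. field. }
  apply (doubling_invariant_value (fun h => gauss_I (sumA h) (sumC h) / h)); auto.
  { intros x Hx. rewrite gauss_I_AC_double by assumption. field. lra. }
  set (x := fun n => 2 ^ n * h).
  set (kap := ln 6 - ln (1 - exp (- h))).
  assert (Hx0 : forall n, h <= x n).
  { intros n. unfold x. assert (1 <= 2 ^ n) by (apply pow_R1_Rle; lra). nra. }
  assert (Hxinv : is_lim_seq (fun n => / x n) 0).
  { replace (Finite 0) with (Rbar_inv p_infty) by reflexivity.
    apply is_lim_seq_inv; [now apply doubling_seq_lim|discriminate]. }
  assert (Hlim : forall u : nat -> R, forall l : R, is_lim_seq u l ->
    is_lim_seq (fun n => (1 + u n * / x n) / (2 * sumB (2 * x n))) (1 / 2)).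
  { intros u l Hu. replace (Finite (1 / 2)) with (Finite ((1 + l * 0) / (2 * 1)))
      by (f_equal; field).
    apply is_lim_seq_div'; [| |lra].
    - apply is_lim_seq_plus'; [apply is_lim_seq_const|].
      apply is_lim_seq_mult'; assumption.
    - apply is_lim_seq_mult'; [apply is_lim_seq_const|]. now apply sumB_double_lim. }
  apply is_lim_seq_le_le with
    (u := fun n => (1 + (- kap) * / x n) / (2 * sumB (2 * x n)))
    (w := fun n => (1 + (2 * sumA (2 * x n) + PI / 2) * / x n) / (2 * sumB (2 * x n))).
  - intros n. fold (x n). specialize (Hx0 n). set (y := x n) in *.
    assert (Hy : 0 < y) by lra. assert (Hy2 : 0 < 2 * y) by lra.
    pose proof (sumB_pos _ Hy2) as HB. pose proof (sumB_lt_sumA _ Hy2) as HBA.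
    pose proof (sumA_ge_1 _ Hy2) as HA. destruct (sumC_sqr _ Hy2) as [HC HC2].
    destruct (gauss_I_log_bounds (sumA (2 * y)) (sumC (2 * y)) (sumB (2 * y)))
      as [Hlo Hup]; try lra.
    pose proof (ln_sumC_double y Hy) as Hln.
    assert (Hk : ln 6 - ln (1 - exp (- y)) <= kap).
    { unfold kap. pose proof (exp_neg_bounds h Hh).
      assert (exp (- y) <= exp (- h)).
      { destruct (Req_dec y h) as [->|Hne]; [lra|left; apply exp_increasing; lra]. }
      assert (ln (1 - exp (- h)) <= ln (1 - exp (- y))) by (apply ln_le; lra). lra. }
    assert (Hl0 : 0 <= ln (sumB (2 * y) + sumA (2 * y))).
    { rewrite <- ln_1. apply ln_le; lra. }
    assert (Hl1 : ln (sumB (2 * y) + sumA (2 * y)) <= 2 * sumA (2 * y)).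
    { pose proof (exp_ineq1_le (ln (sumB (2 * y) + sumA (2 * y)))) as He.
      rewrite exp_ln in He by lra. lra. }
    set (I := gauss_I (sumA (2 * y)) (sumC (2 * y))) in *.
    set (B := sumB (2 * y)) in *. set (A := sumA (2 * y)) in *.
    split.
    + apply Rle_trans with ((ln (B + A) - ln (sumC (2 * y))) / B / (2 * y)).
      * replace ((1 + - kap * / y) / (2 * B)) with ((y - kap) / B / (2 * y)) by (field; lra).
        unfold Rdiv. apply Rmult_le_compat_r; [left; apply Rinv_0_lt_compat; lra|].
        apply Rmult_le_compat_r; [left; apply Rinv_0_lt_compat; lra|]. lra.
      * unfold Rdiv at 1 3. apply Rmult_le_compat_r; [left; apply Rinv_0_lt_compat; lra|lra].
    + apply Rle_trans with ((ln (B + A) - ln (sumC (2 * y)) + PI / 2) / B / (2 * y)).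
      * unfold Rdiv at 1 3. apply Rmult_le_compat_r; [left; apply Rinv_0_lt_compat; lra|lra].
      * replace ((1 + (2 * A + PI / 2) * / y) / (2 * B))
          with ((y + (2 * A + PI / 2)) / B / (2 * y)) by (field; lra).
        unfold Rdiv at 1 4. apply Rmult_le_compat_r; [left; apply Rinv_0_lt_compat; lra|].
        unfold Rdiv at 1 3. apply Rmult_le_compat_r; [left; apply Rinv_0_lt_compat; lra|]. lra.
  - apply Hlim with (- kap). apply is_lim_seq_const.
  - apply Hlim with (2 * 1 + PI / 2).
    apply is_lim_seq_plus'; [|apply is_lim_seq_const].
    apply is_lim_seq_mult'; [apply is_lim_seq_const|]. now apply sumA_double_lim.
Qed.

(** * Elliptic integrals *)

Lemma delta_pos (k t : R) : k ^ 2 < 1 -> 0 < 1 - k ^ 2 * sin t ^ 2.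
Proof. intros Hk. pose proof (sin2_bounds t). pose proof (pow2_ge_0 k). nra. Qed.

Lemma ellipticK_gauss (k a b : R) : 0 < a -> 0 < b -> a ^ 2 * (1 - k ^ 2) = b ^ 2 ->
  ellipticK k = a * gauss_I a b.
Proof.
  intros Ha Hb Hk. unfold ellipticK, gauss_I.
  rewrite <- RInt_scal_R by (apply ex_RInt_cont; intros; now apply gauss_integrand_continuous).
  apply RInt_ext. intros t _.
  change (1 / sqrt (1 - k ^ 2 * sin t ^ 2) = a * / sqrt (gauss_quad a b t)).
  replace (gauss_quad a b t) with (a ^ 2 * (1 - k ^ 2 * sin t ^ 2))
    by (unfold gauss_quad; rewrite <- Hk, cos2_sin2; ring).
  assert (Hk1 : k ^ 2 < 1) by (assert (0 < a ^ 2) by (apply pow_lt; lra);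
    assert (0 < b ^ 2) by (apply pow_lt; lra); nra).
  pose proof (delta_pos k t Hk1) as Hd. pose proof (sqrt_lt_R0 _ Hd).
  rewrite sqrt_mult by (try apply pow2_ge_0; lra). rewrite sqrt_pow2 by lra.
  field. lra.
Qed.

Lemma compl_sqr (k : R) : k ^ 2 <= 1 -> compl_modulus k ^ 2 = 1 - k ^ 2.
Proof. intros Hk. unfold compl_modulus. apply pow2_sqrt. lra. Qed.

Lemma compl_bounds (k : R) : 0 < k < 1 -> 0 < compl_modulus k < 1.
Proof.
  intros Hk. unfold compl_modulus. split; [apply sqrt_lt_R0; nra|].
  rewrite <- sqrt_1 at 2. apply sqrt_lt_1_alt. nra.
Qed.

Lemma ellipticK_integrand_continuous (k t : R) : k ^ 2 < 1 ->
  continuous (fun t => 1 / sqrt (1 - k ^ 2 * sin t ^ 2)) t.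
Proof.
  intros Hk. apply (ex_derive_continuous (K := R_AbsRing) (V := R_NormedModule)).
  pose proof (delta_pos k t Hk) as Hd. pose proof (sqrt_lt_R0 _ Hd).
  auto_derive.
  replace (1 + - (k * (k * 1) * (sin t * (sin t * 1)))) with (1 - k ^ 2 * sin t ^ 2) by ring.
  repeat split; lra.
Qed.

Lemma pow2_lt_1 (k : R) : 0 < k < 1 -> k ^ 2 < 1.
Proof. intros Hk. nra. Qed.

Lemma ellipticK_lt (k1 k2 : R) : 0 < k1 -> k1 < k2 -> k2 < 1 -> ellipticK k1 < ellipticK k2.
Proof.
  intros H1 H12 H2. pose proof PI_RGT_0.
  apply RInt_lt; [lra| | |].
  - intros; apply ellipticK_integrand_continuous, pow2_lt_1; lra.
  - intros; apply ellipticK_integrand_continuous, pow2_lt_1; lra.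
  - intros t Ht.
    pose proof (delta_pos k1 t (pow2_lt_1 k1 ltac:(lra))).
    pose proof (delta_pos k2 t (pow2_lt_1 k2 ltac:(lra))) as Hd2.
    pose proof (sqrt_lt_R0 _ Hd2).
    assert (Hs : 0 < sin t ^ 2) by (apply pow_lt, sin_gt_0; lra).
    unfold Rdiv. rewrite !Rmult_1_l. apply Rinv_lt_contravar.
    + apply Rmult_lt_0_compat; apply sqrt_lt_R0; lra.
    + apply sqrt_lt_1_alt. split; [lra|].
      assert (k1 ^ 2 < k2 ^ 2) by nra. nra.
Qed.

Lemma ellipticK_pos (k : R) : k ^ 2 < 1 -> 0 < ellipticK k.
Proof.
  intros Hk. pose proof PI_RGT_0.
  apply RInt_gt_0; [lra| |].
  - intros t _. apply Rdiv_lt_0_compat; [lra|]. now apply sqrt_lt_R0, delta_pos.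
  - intros; now apply ellipticK_integrand_continuous.
Qed.

(** The nome of modulus [k] is [exp (- nome_exponent k)]. *)
Definition nome_exponent (k : R) : R := PI * ellipticK (compl_modulus k) / ellipticK k.

Lemma nome_exponent_pos (k : R) : 0 < k < 1 -> 0 < nome_exponent k.
Proof.
  intros Hk. unfold nome_exponent. pose proof PI_RGT_0. pose proof (compl_bounds k Hk).
  apply Rdiv_lt_0_compat; [apply Rmult_lt_0_compat; [lra|]|]; apply ellipticK_pos, pow2_lt_1; lra.
Qed.

Lemma nome_exponent_decreasing (k1 k2 : R) :
  0 < k1 -> k1 < k2 -> k2 < 1 -> nome_exponent k2 < nome_exponent k1.
Proof.
  intros H1 H12 H2. pose proof PI_RGT_0.
  pose proof (compl_bounds k1 ltac:(lra)). pose proof (compl_bounds k2 ltac:(lra)).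
  pose proof (ellipticK_lt k1 k2 H1 H12 H2) as HK.
  pose proof (ellipticK_pos k1 (pow2_lt_1 k1 ltac:(lra))).
  assert (Hc : compl_modulus k2 < compl_modulus k1).
  { unfold compl_modulus. apply sqrt_lt_1_alt.
    assert (k2 ^ 2 < 1) by (apply pow2_lt_1; lra).
    assert (k1 ^ 2 < k2 ^ 2) by nra. split; lra. }
  pose proof (ellipticK_lt _ _ ltac:(apply (compl_bounds k2); lra) Hc ltac:(lra)) as HK'.
  pose proof (ellipticK_pos _ (pow2_lt_1 (compl_modulus k2) ltac:(lra))).
  unfold nome_exponent, Rdiv.
  apply Rlt_trans with (PI * ellipticK (compl_modulus k1) * / ellipticK k2).
  - apply Rmult_lt_compat_r; [apply Rinv_0_lt_compat; lra|]. apply Rmult_lt_compat_l; lra.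
  - apply Rmult_lt_compat_l; [apply Rmult_lt_0_compat; lra|].
    apply Rinv_lt_contravar; [nra|lra].
Qed.

Lemma nome_exponent_inj (k1 k2 : R) : 0 < k1 < 1 -> 0 < k2 < 1 ->
  nome_exponent k1 = nome_exponent k2 -> k1 = k2.
Proof.
  intros H1 H2 He. destruct (Rtotal_order k1 k2) as [H|[H|H]]; [|assumption|].
  - pose proof (nome_exponent_decreasing k1 k2). lra.
  - pose proof (nome_exponent_decreasing k2 k1). lra.
Qed.

(** The modulus [C / A] attached to [h = nome_exponent k] has the same nome exponent as
    [k], hence equals [k]. *)
Lemma sums_elliptic (k : R) : 0 < k < 1 ->
  sumA (nome_exponent k) = 2 * ellipticK k / PI /\
  sumB (nome_exponent k) = compl_modulus k * (2 * ellipticK k / PI).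
Proof.
  intros Hk. pose proof PI_RGT_0 as HPI.
  pose proof (nome_exponent_pos k Hk) as Hh. set (h := nome_exponent k) in *.
  pose proof (sumB_pos h Hh) as HB. pose proof (sumB_lt_sumA h Hh) as HBA.
  destruct (sumC_sqr h Hh) as [HC HC2].
  set (A := sumA h) in *. set (B := sumB h) in *. set (C := sumC h) in *.
  assert (HA : 0 < A) by lra.
  set (k0 := C / A).
  assert (Hk0 : k0 * A = C) by (unfold k0; field; lra).
  assert (Hk01 : 0 < k0 < 1).
  { unfold k0. split; [apply Rdiv_lt_0_compat; lra|].
    apply Rmult_lt_reg_r with A; [lra|]. fold k0. rewrite Hk0, Rmult_1_l.
    assert (0 < B ^ 2) by (apply pow_lt; assumption).
    apply Rsqr_incrst_0; unfold Rsqr; lra. }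
  assert (HK : ellipticK k0 = A * (PI / 2)).
  { rewrite <- (gauss_I_AB h Hh). apply ellipticK_gauss; try assumption.
    fold A B. replace (B ^ 2) with (A ^ 2 - C ^ 2) by lra. rewrite <- Hk0. ring. }
  assert (Hc0 : compl_modulus k0 ^ 2 = 1 - k0 ^ 2) by (apply compl_sqr; nra).
  assert (HK' : ellipticK (compl_modulus k0) = A * (h / 2)).
  { rewrite <- (gauss_I_AC h Hh). apply ellipticK_gauss; try assumption.
    fold A C. rewrite Hc0, <- Hk0. ring. }
  assert (Heq : k0 = k).
  { apply nome_exponent_inj; try assumption. unfold nome_exponent at 1.
    rewrite HK, HK'. fold h. field. lra. }
  rewrite <- Heq. split.
  - rewrite HK. field. lra.
  - rewrite HK. replace (2 * (A * (PI / 2)) / PI) with A by (field; lra).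
    apply Rsqr_inj; [lra| |].
    + pose proof (compl_bounds k0 Hk01). nra.
    + unfold Rsqr. transitivity (compl_modulus k0 ^ 2 * A ^ 2); [|ring].
      rewrite Hc0. rewrite <- Hk0 in HC2.
      lra.
Qed.

Lemma sumV_elliptic (k : R) : 0 < k < 1 ->
  sumV (2 * nome_exponent k)
  = ellipticK k / PI * sqrt (compl_modulus k) * (sqrt (1 + k) + sqrt (1 - k)).
Proof.
  intros Hk. pose proof PI_RGT_0 as HPI.
  pose proof (nome_exponent_pos k Hk) as Hh. pose proof (compl_bounds k Hk) as Hc.
  destruct (sumV_double _ Hh) as [HV HV2]. destruct (sums_elliptic k Hk) as [HA HB].
  pose proof (ellipticK_pos k (pow2_lt_1 k Hk)) as HK.
  pose proof (sqrt_lt_R0 _ (proj1 Hc)) as Hsc.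
  pose proof (sqrt_lt_R0 (1 + k) ltac:(lra)). pose proof (sqrt_lt_R0 (1 - k) ltac:(lra)).
  apply Rsqr_inj; [lra| |].
  - assert (0 < ellipticK k / PI) by (apply Rdiv_lt_0_compat; lra).
    apply Rmult_le_pos; [apply Rmult_le_pos|]; lra.
  - unfold Rsqr. transitivity (sumV (2 * nome_exponent k) ^ 2); [ring|].
    rewrite HV2, HA, HB.
    assert (Hprod : sqrt (1 + k) * sqrt (1 - k) = compl_modulus k).
    { rewrite <- sqrt_mult by lra. unfold compl_modulus. f_equal. ring. }
    pose proof (pow2_sqrt (1 + k) ltac:(lra)) as H1.
    pose proof (pow2_sqrt (1 - k) ltac:(lra)) as H2.
    pose proof (pow2_sqrt (compl_modulus k) ltac:(lra)) as H3.
    transitivity ((ellipticK k / PI) ^ 2 * sqrt (compl_modulus k) ^ 2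
      * (sqrt (1 + k) ^ 2 + sqrt (1 - k) ^ 2 + 2 * (sqrt (1 + k) * sqrt (1 - k)))).
    + rewrite H1, H2, H3, Hprod. field. lra.
    + ring.
Qed.

(** * The Lambert series *)

Lemma sumZ_symmetric (f : Z -> R) : geo f ->
  sumZ f = f 0%Z + Series (fun n => f (Z.of_nat (S n)) + f (- Z.of_nat (S n))%Z).
Proof.
  intros Hf. assert (Hf' := Hf). destruct Hf' as (C & s & Hs & H).
  assert (H1 : ex_series (fun n => f (Z.of_nat n))).
  { apply ex_series_bound with (fun n => C * s ^ n); [|apply ex_series_geom_scal; lra].
    intros n. eapply Rle_trans; [apply H|]. rewrite abs_nat_of_nat. lra. }
  assert (H2 : ex_series (fun n => f (-1 - Z.of_nat n)%Z)).
  { apply ex_series_bound with (fun n => C * s * s ^ n); [|apply ex_series_geom_scal; lra].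
    intros n. eapply Rle_trans; [apply H|]. rewrite abs_nat_neg. simpl. lra. }
  unfold sumZ, fold_term. rewrite Series_plus by assumption.
  rewrite (Series_incr_1 _ H1).
  rewrite (Series_plus (fun n => f (Z.of_nat (S n)))).
  - rewrite (Series_ext (fun n => f (-1 - Z.of_nat n)%Z) (fun n => f (- Z.of_nat (S n))%Z))
      by (intros n; f_equal; lia).
    simpl. ring.
  - now apply (ex_series_tail (fun n => f (Z.of_nat n)) 1).
  - apply ex_series_ext with (2 := H2). intros n. f_equal. lia.
Qed.

(** As a function of the odd number [2 * n + 1], the quadratic character modulo [8] of
    discriminant [-8]. *)
Definition chi (n : nat) : R := (-1) ^ Nat.div n 2.

Lemma chi_abs (n : nat) : Rabs (chi n) = 1.
Proof. apply pow_1_abs. Qed.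

Lemma chi_double (n : nat) : chi (2 * n) = (-1) ^ n /\ chi (S (2 * n)) = (-1) ^ n.
Proof.
  unfold chi. split; f_equal.
  - symmetry. apply Nat.div_unique with 0%nat; lia.
  - symmetry. apply Nat.div_unique with 1%nat; lia.
Qed.

Lemma chi_generating (x : R) : 0 <= x < 1 ->
  Series (fun n => chi n * x ^ S (2 * n)) = (x + x ^ 3) / (1 + x ^ 4).
Proof.
  intros Hx.
  assert (He : ex_series (fun n => chi n * x ^ S (2 * n))).
  { apply ex_series_bound with (fun n => x * (x ^ 2) ^ n).
    - intros n. rewrite Rabs_mult, chi_abs, Rmult_1_l, Rabs_pos_eq by (apply pow_le; lra).
      rewrite <- pow_mult. simpl. lra.
    - apply ex_series_geom_scal. nra. }
  rewrite <- (Series_group2 _ He).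
  rewrite (Series_ext _ (fun n => (x + x ^ 3) * (- x ^ 4) ^ n)).
  - rewrite Series_scal_l. unfold Rdiv. f_equal.
    replace (1 + x ^ 4) with (1 - - x ^ 4) by ring.
    apply is_series_unique, is_series_geom.
    rewrite Rabs_Ropp, Rabs_pos_eq by (apply pow_le; lra).
    assert (0 <= x ^ 2 < 1) by nra. nra.
  - intros n. destruct (chi_double n) as [-> ->].
    replace (- x ^ 4) with (-1 * x ^ 4) by ring. rewrite Rpow_mult_distr, <- pow_mult.
    replace (x ^ S (2 * (2 * n))) with (x * x ^ (4 * n))
      by (simpl; do 2 f_equal; lia).
    replace (S (2 * S (2 * n))) with (3 + 4 * n)%nat by lia.
    rewrite pow_add. ring.
Qed.

Lemma alternating_geometric (x : R) : 0 <= x < 1 ->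
  Series (fun j => (-1) ^ S j * x ^ S j) = - (x / (1 + x)).
Proof.
  intros Hx. rewrite (Series_ext _ (fun j => (- x) * (- x) ^ j)).
  - assert (H : Series (pow (- x)) = / (1 - - x)).
    { apply is_series_unique, is_series_geom. rewrite Rabs_Ropp, Rabs_pos_eq; lra. }
    rewrite Series_scal_l, H. field. lra.
  - intros j. rewrite <- Rpow_mult_distr. replace (-1 * x) with (- x) by ring. reflexivity.
Qed.

Lemma sgn_of_nat (n : nat) : sgn (Z.of_nat n) = (-1) ^ n.
Proof.
  induction n as [|n IH]; [reflexivity|].
  rewrite Nat2Z.inj_succ. unfold Z.succ. rewrite sgn_add, IH.
  change (sgn 1) with (-1). simpl. ring.
Qed.

(** Both sides are iterated sums of [(-1)^j * chi n * exp (- j * (2 * n + 1) * h)] over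
    [j >= 1] and [n >= 0], after folding [j] with [- j] in the bilateral sum. *)
Lemma sumV_lambert (h : R) : 0 < h ->
  sumV (2 * h) = 1 - 2 * Series (fun n => chi n * / (exp ((2 * INR n + 1) * h) + 1)).
Proof.
  intros Hh. pose proof (exp_neg_bounds h Hh) as Hq. set (q := exp (- h)) in *.
  assert (Hg : geo (fun z => sgn z * (half_weight (2 * h) z * sech (IZR z * (2 * h)))))
    by (apply geo_bounded_mult with 1; [apply sgn_le_1|apply geo_half_weight_sech; lra]).
  unfold sumV. rewrite (sumZ_symmetric _ Hg).
  rewrite half_weight_0, Rmult_0_l, sech_0. change (sgn 0) with 1.
  set (F := fun j n => (-1) ^ S j * (chi n * (q ^ S j) ^ S (2 * n))).
  rewrite (Series_ext _ (fun j => 2 * Series (F j))).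
  - rewrite Series_scal_l.
    rewrite (Series_swap F (fun j => q ^ j) (fun n => q ^ n)).
    + rewrite (Series_ext _ (fun n => (-1) * (chi n * / (exp ((2 * INR n + 1) * h) + 1)))).
      * rewrite Series_scal_l. ring.
      * intros n. unfold F.
        rewrite (Series_ext _ (fun j => chi n * ((-1) ^ S j * (q ^ S (2 * n)) ^ S j))).
        -- rewrite Series_scal_l, alternating_geometric.
           ++ assert (Hx : q ^ S (2 * n) = / exp ((2 * INR n + 1) * h)).
              { unfold q. rewrite <- exp_INR_mult, <- exp_Ropp. f_equal.
                rewrite S_INR, mult_INR. simpl. ring. }
              rewrite Hx. pose proof (exp_pos ((2 * INR n + 1) * h)). field. lra.
           ++ split; [apply pow_le; lra|]. simpl. pose proof (pow_le_1 q (n + (n + 0)) Hq). nra.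
        -- intros j. rewrite <- !pow_mult, (Nat.mul_comm (S j)). ring.
    + intros n; apply pow_le; lra.
    + intros n; apply pow_le; lra.
    + intros j n. unfold F. rewrite !Rabs_mult, chi_abs, pow_1_abs, !Rmult_1_l.
      rewrite Rabs_pos_eq by (apply pow_le, pow_le; lra).
      rewrite <- pow_mult, <- pow_add. apply pow_anti; [assumption|nia].
    + exists (/ (1 - q)). apply is_series_geom. rewrite Rabs_pos_eq; lra.
    + exists (/ (1 - q)). apply is_series_geom. rewrite Rabs_pos_eq; lra.
  - intros j. unfold F. rewrite Series_scal_l, chi_generating.
    + rewrite sgn_opp, sgn_of_nat, opp_IZR, <- Ropp_mult_distr_l, sech_opp.
      unfold half_weight. rewrite opp_IZR, <- INR_IZR_INZ.
      replace (2 * h / 2) with h by field.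
      replace (- (- INR (S j) * h)) with (INR (S j) * h) by ring.
      assert (Hx : q ^ S j = exp (- (INR (S j) * h))).
      { unfold q. rewrite <- exp_INR_mult. f_equal. ring. }
      rewrite Hx. set (y := INR (S j) * h).
      replace (INR (S j) * (2 * h)) with (y + y) by (unfold y; ring).
      unfold sech, cosh. rewrite Ropp_plus_distr, !exp_plus.
      replace (exp y) with (/ exp (- y)) by (rewrite exp_Ropp, Rinv_inv; reflexivity).
      pose proof (exp_pos (- y)). set (x := exp (- y)) in *.
      assert (0 < x ^ 4) by (apply pow_lt; assumption).
      field. repeat split; nra.
    + split; [apply pow_le; lra|]. simpl. pose proof (pow_le_1 q j Hq). nra.
Qed.

(** * Termwise differentiation *)

Lemma CVU_dom_series (f : nat -> R -> R) (D : R -> Prop) (M : nat -> R) :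
  (forall n x, D x -> Rabs (f n x) <= M n) -> ex_series M ->
  CVU_dom (fun N x => sum_n (fun n => f n x) N) D.
Proof.
  intros Hb HM eps.
  pose proof (Series_tail_lim M HM) as Ht. apply is_lim_seq_spec in Ht.
  destruct (Ht eps) as [N0 HN0]. exists N0. intros n Hn x Hx.
  specialize (HN0 n Hn). rewrite Rminus_0_r in HN0.
  change (real (Lim_seq (fun N => sum_n (fun k => f k x) N))) with (Series (fun k => f k x)).
  assert (He : ex_series (fun k => f k x)) by (apply ex_series_bound with M; auto).
  rewrite (Series_incr_n (fun k => f k x) (S n)) by (auto; lia).
  simpl pred. rewrite <- sum_n_Reals.
  rewrite Rabs_minus_sym.
  replace (_ - _) with (Series (fun k => f (S n + k)%nat x)) by ring.
  eapply Rle_lt_trans; [|exact HN0]. eapply Rle_trans; [|apply Rle_abs].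
  apply Series_bound; [intros; now apply Hb|now apply ex_series_tail].
Qed.

Lemma continuous_sum_n_R (f : nat -> R -> R) (x : R) (N : nat) :
  (forall n, continuous (f n) x) -> continuous (fun y => sum_n (fun n => f n y) N) x.
Proof.
  intros H. induction N as [|N IH].
  - apply continuous_ext with (f 0%nat); [|apply H]. intros t. now rewrite sum_O.
  - apply continuous_ext with (fun y => plus (sum_n (fun n => f n y) N) (f (S N) y)).
    + intros t. now rewrite sum_Sn.
    + apply (continuous_plus (K := R_AbsRing) (V := R_NormedModule)); [exact IH|apply H].
Qed.

Lemma is_derive_Series (f f' : nat -> R -> R) (D : R -> Prop) (M M' : nat -> R) :
  open D -> is_connected D ->
  (forall n x, D x -> is_derive (f n) x (f' n x)) ->
  (forall n x, D x -> continuous (f' n) x) ->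
  (forall n x, D x -> Rabs (f n x) <= M n) -> ex_series M ->
  (forall n x, D x -> Rabs (f' n x) <= M' n) -> ex_series M' ->
  forall x, D x -> is_derive (fun y => Series (fun n => f n y)) x (Series (fun n => f' n x)).
Proof.
  intros Ho Hcn Hd Hc Hb HM Hb' HM' x Hx.
  assert (HD : forall N y, D y -> Derive (fun z => sum_n (fun n => f n z) N) y
               = sum_n (fun n => f' n y) N).
  { intros N y Hy.
    apply is_derive_unique, (is_derive_sum_n (K := R_AbsRing) (V := R_NormedModule)). auto. }
  pose proof (CVU_Derive (fun N y => sum_n (fun n => f n y) N) D Ho Hcn
    (CVU_dom_series f D M Hb HM)) as H.
  replace (Series (fun n => f' n x)) with
    (real (Lim_seq (fun N => Derive (fun z => sum_n (fun n => f n z) N) x))).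
  - apply H; auto.
    + intros N y Hy. exists (sum_n (fun n => f' n y) N).
      apply (is_derive_sum_n (K := R_AbsRing) (V := R_NormedModule)). auto.
    + intros N y Hy. apply continuity_pt_filterlim.
      apply (continuous_ext_loc _ (fun z => sum_n (fun n => f' n z) N)).
      * apply filter_imp with D; [|now apply Ho]. intros z Hz. symmetry. now apply HD.
      * apply continuous_sum_n_R. auto.
    + pose proof (CVU_dom_series f' D M' Hb' HM') as Hu.
      intros eps. destruct (Hu eps) as [N0 HN0]. exists N0. intros n Hn y Hy.
      rewrite HD by assumption.
      rewrite (Lim_seq_ext _ (fun N => sum_n (fun k => f' k y) N)) by (intros; now apply HD).
      now apply HN0.
  - unfold Series. f_equal. apply Lim_seq_ext. intros N. now apply HD.
Qed.

Definition lambert_term (n : nat) (h : R) : R := chi n * / (exp ((2 * INR n + 1) * h) + 1).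

Lemma lambert_term_derive (n : nat) (h : R) :
  is_derive (lambert_term n) h
    (- (1 / 4) * (chi n * (2 * INR n + 1) * sech ((2 * INR n + 1) * h / 2) ^ 2)).
Proof.
  unfold lambert_term. set (m := 2 * INR n + 1).
  pose proof (exp_pos (m * h)). auto_derive; [lra|].
  unfold sech, cosh.
  replace (exp (m * h)) with (exp (m * h / 2) * exp (m * h / 2))
    by (rewrite <- exp_plus; f_equal; field).
  replace (exp (- (m * h / 2))) with (/ exp (m * h / 2)) by (rewrite <- exp_Ropp; reflexivity).
  pose proof (exp_pos (m * h / 2)). field. split; nra.
Qed.

Lemma odd_ge_1 (n : nat) : 1 <= 2 * INR n + 1.
Proof. pose proof (pos_INR n). lra. Qed.

Lemma exp_odd (c : R) (n : nat) : exp (- ((2 * INR n + 1) * c)) = exp (- c) * (exp (- (2 * c))) ^ n.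
Proof. rewrite <- exp_INR_mult, <- exp_plus. f_equal. ring. Qed.

(** The derivatives of the terms are summable uniformly on [y > h / 2]; there
    [m * exp (- m * c)] is absorbed by half of its exponential, whence the factor [2 / c]
    in the majorant. *)
Lemma sumV_derive (h : R) : 0 < h ->
  is_derive (fun y => sumV (2 * y)) h
    (1 / 2 * Series (fun n => chi n * (2 * INR n + 1) * sech ((2 * INR n + 1) * h / 2) ^ 2)).
Proof.
  intros Hh.
  set (f' := fun n y => - (1 / 4) * (chi n * (2 * INR n + 1) * sech ((2 * INR n + 1) * y / 2) ^ 2)).
  set (c := h / 2). assert (Hc : 0 < c) by (unfold c; lra).
  assert (Hd : is_derive (fun y => Series (fun n => lambert_term n y)) h
    (Series (fun n => f' n h))).
  { apply is_derive_Series with (D := fun y => c < y)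
      (M := fun n => exp (- c) * (exp (- (2 * c))) ^ n)
      (M' := fun n => 2 / c * exp (- (c / 2)) * (exp (- (2 * (c / 2)))) ^ n).
    - apply open_gt.
    - intros x y z Hx Hy Hz. lra.
    - intros n x _. apply lambert_term_derive.
    - intros n x _. apply (ex_derive_continuous (K := R_AbsRing) (V := R_NormedModule)).
      unfold f', sech, cosh. auto_derive.
      pose proof (exp_pos ((2 * INR n + 1) * x / 2)).
      pose proof (exp_pos (- ((2 * INR n + 1) * x / 2))). unfold Rdiv in *. lra.
    - intros n x Hx. rewrite <- exp_odd. unfold lambert_term.
      pose proof (odd_ge_1 n). pose proof (exp_pos ((2 * INR n + 1) * x)).
      rewrite Rabs_mult, chi_abs, Rmult_1_l, Rabs_pos_eq
        by (left; apply Rinv_0_lt_compat; lra).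
      rewrite exp_Ropp. apply Rinv_le_contravar; [apply exp_pos|].
      assert (exp ((2 * INR n + 1) * c) < exp ((2 * INR n + 1) * x))
        by (apply exp_increasing; nra). lra.
    - apply ex_series_geom_scal. pose proof (exp_neg_bounds (2 * c)). lra.
    - intros n x Hx. rewrite Rmult_assoc, <- exp_odd.
      set (m := 2 * INR n + 1). assert (Hm : 1 <= m) by apply odd_ge_1.
      unfold f'. fold m. rewrite !Rabs_mult, chi_abs, Rmult_1_l, Rabs_Ropp.
      rewrite (Rabs_pos_eq (1 / 4)), (Rabs_pos_eq m), <- RPow_abs by lra.
      rewrite (Rabs_pos_eq (sech _)) by (left; apply sech_pos).
      assert (Hs : sech (m * x / 2) <= 2 * exp (- (m * c / 2))).
      { eapply Rle_trans; [apply sech_upper|]. rewrite Rabs_pos_eq by nra.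
        apply Rmult_le_compat_l; [lra|]. left. apply exp_increasing. nra. }
      pose proof (sech_pos (m * x / 2)) as Hs0.
      assert (Hs2 : sech (m * x / 2) ^ 2 <= 4 * exp (- (m * c))).
      { replace (exp (- (m * c))) with (exp (- (m * c / 2)) * exp (- (m * c / 2)))
          by (rewrite <- exp_plus; f_equal; field). nra. }
      assert (Hexp : m * c / 2 <= exp (m * c / 2)).
      { pose proof (exp_ineq1_le (m * c / 2)). lra. }
      apply Rle_trans with (m * exp (- (m * c))).
      { nra. }
      replace (m * (c / 2)) with (m * c / 2) by field.
      replace (exp (- (m * c))) with (exp (- (m * c / 2)) * exp (- (m * c / 2)))
        by (rewrite <- exp_plus; f_equal; field).
      pose proof (exp_mul_exp_opp (m * c / 2)) as Hinv.
      set (E := exp (m * c / 2)) in *. set (e := exp (- (m * c / 2))) in *.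
      assert (He : 0 < e) by apply exp_pos.
      rewrite <- Rmult_assoc. apply Rmult_le_compat_r; [lra|].
      apply Rmult_le_reg_l with (c / 2); [lra|].
      replace (c / 2 * (2 / c)) with 1 by (field; lra).
      replace (c / 2 * (m * e)) with (m * c / 2 * e) by field. nra.
    - apply ex_series_geom_scal. pose proof (exp_neg_bounds (2 * (c / 2))). lra.
    - unfold c. lra. }
  replace (1 / 2 * _) with (0 - 2 * Series (fun n => f' n h)).
  - apply is_derive_ext_loc with (fun y => 1 - 2 * Series (fun n => lambert_term n y)).
    + apply filter_imp with (fun y => 0 < y); [|now apply (open_gt 0)].
      intros y Hy. symmetry. now apply sumV_lambert.
    + apply (is_derive_minus (K := R_AbsRing) (V := R_NormedModule) (fun _ => 1)
        (fun y => 2 * Series (fun n => lambert_term n y))).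
      * apply (is_derive_const (K := R_AbsRing) (V := R_NormedModule)).
      * apply (is_derive_scal (fun y => Series (fun n => lambert_term n y)) h 2 _ Hd).
  - unfold f'. rewrite Series_scal_l. field.
Qed.

(** * Derivative of the elliptic integral in the modulus *)

Lemma is_derive_value (f : R -> R) (x l1 l2 : R) :
  is_derive f x l1 -> l1 = l2 -> is_derive f x l2.
Proof. now intros H <-. Qed.

(** The derivative in the modulus [u] of the integrand of [ellipticK u]. *)
Definition dellipticK (u t : R) : R :=
  u * sin t ^ 2 * / ((1 - u ^ 2 * sin t ^ 2) * sqrt (1 - u ^ 2 * sin t ^ 2)).

Lemma ellipticK_integrand_derive (u t : R) : u ^ 2 < 1 ->
  is_derive (fun z => 1 / sqrt (1 - z ^ 2 * sin t ^ 2)) u (dellipticK u t).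
Proof.
  intros Hu. pose proof (delta_pos u t Hu) as Hd. pose proof (sqrt_lt_R0 _ Hd) as Hs.
  unfold dellipticK.
  auto_derive;
  replace (1 + - (u * (u * 1) * (sin t * (sin t * 1)))) with (1 - u ^ 2 * sin t ^ 2) by ring.
  - repeat split; lra.
  - pose proof (sqrt_sqrt (1 - u ^ 2 * sin t ^ 2) ltac:(lra)) as Hss.
    set (d := sqrt (1 - u ^ 2 * sin t ^ 2)) in *. rewrite <- Hss. field. lra.
Qed.

Lemma locally_pow2_lt_1 (k : R) : 0 < k < 1 -> locally k (fun u : R => u ^ 2 < 1).
Proof.
  intros Hk. apply filter_imp with (fun u => 0 < u /\ u < 1).
  - intros u Hu. nra.
  - apply (open_and (fun u => 0 < u) (fun u => u < 1)); [apply open_gt|apply open_lt|exact Hk].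
Qed.

Lemma dellipticK_continuity_2d (k t : R) : k ^ 2 < 1 -> continuity_2d_pt dellipticK k t.
Proof.
  intros Hk. pose proof (delta_pos k t Hk) as Hd. pose proof (sqrt_lt_R0 _ Hd) as Hs.
  assert (Hsin : continuity_2d_pt (fun _ v => sin v) k t).
  { apply (continuity_1d_2d_pt_comp sin (fun _ v => v)); [apply continuity_sin|].
    apply continuity_2d_pt_id2. }
  assert (Hsin2 : continuity_2d_pt (fun _ v => sin v ^ 2) k t).
  { apply continuity_2d_pt_ext with (fun _ v => sin v * sin v); [intros; simpl; ring|].
    now apply continuity_2d_pt_mult. }
  assert (Hq : continuity_2d_pt (fun u v => 1 - u ^ 2 * sin v ^ 2) k t).
  { apply continuity_2d_pt_minus; [apply continuity_2d_pt_const|].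
    apply continuity_2d_pt_mult; [|assumption].
    apply continuity_2d_pt_ext with (fun u _ => u * u); [intros; simpl; ring|].
    apply continuity_2d_pt_mult; apply continuity_2d_pt_id1. }
  apply continuity_2d_pt_mult.
  - apply continuity_2d_pt_mult; [apply continuity_2d_pt_id1|assumption].
  - apply continuity_2d_pt_inv; [|apply Rgt_not_eq; nra].
    apply continuity_2d_pt_mult; [assumption|].
    apply (continuity_1d_2d_pt_comp sqrt (fun u v => 1 - u ^ 2 * sin v ^ 2)); [|assumption].
    apply continuity_pt_sqrt. lra.
Qed.

Lemma ellipticE_integrand_continuous (k t : R) : k ^ 2 < 1 ->
  continuous (fun t => sqrt (1 - k ^ 2 * sin t ^ 2)) t.
Proof.
  intros Hk. apply (ex_derive_continuous (K := R_AbsRing) (V := R_NormedModule)).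
  pose proof (delta_pos k t Hk) as Hd. pose proof (sqrt_lt_R0 _ Hd).
  auto_derive.
  replace (1 + - (k * (k * 1) * (sin t * (sin t * 1)))) with (1 - k ^ 2 * sin t ^ 2) by ring.
  repeat split; lra.
Qed.

Lemma dellipticK_continuous (k t : R) : k ^ 2 < 1 -> continuous (dellipticK k) t.
Proof.
  intros Hk. apply (ex_derive_continuous (K := R_AbsRing) (V := R_NormedModule)).
  pose proof (delta_pos k t Hk) as Hd. pose proof (sqrt_lt_R0 _ Hd).
  unfold dellipticK. auto_derive.
  replace (1 + - (k * (k * 1) * (sin t * (sin t * 1)))) with (1 - k ^ 2 * sin t ^ 2) by ring.
  repeat split; try lra. apply Rgt_not_eq. nra.
Qed.

(** With [d = sqrt (1 - k^2 sin^2)], the function [d / (k k'^2) - 1 / (k d)] differs from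
    the integrand by the derivative of [(k / k'^2) * sin * cos / d], which vanishes at
    both ends. *)
Lemma dellipticK_integral (k : R) : 0 < k < 1 ->
  RInt (dellipticK k) 0 (PI / 2)
  = (ellipticE k - (1 - k ^ 2) * ellipticK k) / (k * (1 - k ^ 2)).
Proof.
  intros Hk. pose proof (pow2_lt_1 k Hk) as Hk2.
  set (c2 := 1 - k ^ 2). assert (Hc2 : 0 < c2) by (unfold c2; lra).
  set (fE := fun t => sqrt (1 - k ^ 2 * sin t ^ 2)).
  set (fK := fun t => 1 / sqrt (1 - k ^ 2 * sin t ^ 2)).
  set (G := fun t => k / c2 * (sin t * cos t / sqrt (1 - k ^ 2 * sin t ^ 2))).
  set (g := fun t => / (k * c2) * fE t - (/ k * fK t + dellipticK k t)).
  assert (HfE : forall t, continuous fE t) by (intros; now apply ellipticE_integrand_continuous).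
  assert (HfK : forall t, continuous fK t) by (intros; now apply ellipticK_integrand_continuous).
  assert (HdK : forall t, continuous (dellipticK k) t)
    by (intros; now apply dellipticK_continuous).
  assert (HE : is_RInt fE 0 (PI / 2) (ellipticE k))
    by (apply (RInt_correct (V := R_CompleteNormedModule)); now apply ex_RInt_cont).
  assert (HK : is_RInt fK 0 (PI / 2) (ellipticK k))
    by (apply (RInt_correct (V := R_CompleteNormedModule)); now apply ex_RInt_cont).
  assert (HD : is_RInt (dellipticK k) 0 (PI / 2) (RInt (dellipticK k) 0 (PI / 2)))
    by (apply (RInt_correct (V := R_CompleteNormedModule)); now apply ex_RInt_cont).
  assert (Hg1 : is_RInt g 0 (PI / 2) (/ (k * c2) * ellipticE k
      - (/ k * ellipticK k + RInt (dellipticK k) 0 (PI / 2)))).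
  { apply (is_RInt_minus (V := R_NormedModule) (fun t => / (k * c2) * fE t)
      (fun t => / k * fK t + dellipticK k t)).
    - exact (is_RInt_scal (V := R_NormedModule) fE 0 (PI / 2) (/ (k * c2)) _ HE).
    - apply (is_RInt_plus (V := R_NormedModule) (fun t => / k * fK t)); [|exact HD].
      exact (is_RInt_scal (V := R_NormedModule) fK 0 (PI / 2) (/ k) _ HK). }
  assert (Hg2 : is_RInt g 0 (PI / 2) (minus (G (PI / 2)) (G 0))).
  { apply (is_RInt_derive (V := R_CompleteNormedModule)).
    - intros t _. pose proof (delta_pos k t Hk2) as Hd. pose proof (sqrt_lt_R0 _ Hd) as Hs.
      unfold G, g, fE, fK, dellipticK. auto_derive;
      replace (1 + - (k * (k * 1) * (sin t * (sin t * 1)))) with (1 - k ^ 2 * sin t ^ 2) by ring.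
      + repeat split; lra.
      + pose proof (pow2_sqrt (1 - k ^ 2 * sin t ^ 2) ltac:(lra)) as Hss.
        pose proof (cos2_sin2 t) as Hcs.
        set (d := sqrt (1 - k ^ 2 * sin t ^ 2)) in *. set (s := sin t) in *.
        set (c := cos t) in *. rewrite <- Hss.
        assert (Hd2 : d ^ 2 = 1 - k ^ 2 * s ^ 2) by exact Hss.
        transitivity ((d ^ 2 * (c ^ 2 - s ^ 2) + k ^ 2 * s ^ 2 * c ^ 2) * k / (c2 * d ^ 3)).
        * field. lra.
        * transitivity ((d ^ 4 - c2 * d ^ 2 - c2 * k ^ 2 * s ^ 2) / (k * c2 * d ^ 3)).
          -- rewrite Hcs.
             replace (d ^ 4 - c2 * d ^ 2 - c2 * k ^ 2 * s ^ 2)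
               with (d ^ 2 * d ^ 2 - c2 * d ^ 2 - c2 * k ^ 2 * s ^ 2) by ring.
             replace (d ^ 2 * (1 - s ^ 2 - s ^ 2) + k ^ 2 * s ^ 2 * (1 - s ^ 2))
               with ((d ^ 2 * d ^ 2 - c2 * d ^ 2 - c2 * k ^ 2 * s ^ 2) / k ^ 2).
             ++ field. lra.
             ++ rewrite Hd2. unfold c2. field. lra.
          -- field. lra.
    - intros t _. unfold g.
      apply (continuous_minus (K := R_AbsRing) (V := R_NormedModule) (fun t => / (k * c2) * fE t)
        (fun t => / k * fK t + dellipticK k t)).
      + apply (continuous_scal_r (K := R_AbsRing) (V := R_NormedModule) (/ (k * c2)) fE), HfE.
      + apply (continuous_plus (K := R_AbsRing) (V := R_NormedModule) (fun t => / k * fK t)).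
        * apply (continuous_scal_r (K := R_AbsRing) (V := R_NormedModule) (/ k) fK), HfK.
        * apply HdK. }
  apply (is_RInt_unique (V := R_CompleteNormedModule)) in Hg1.
  apply (is_RInt_unique (V := R_CompleteNormedModule)) in Hg2.
  rewrite Hg1 in Hg2. unfold minus, plus, opp in Hg2; simpl in Hg2.
  unfold G in Hg2. rewrite cos_PI2, sin_0 in Hg2.
  assert (H0 : / (k * c2) * ellipticE k
      - (/ k * ellipticK k + RInt (dellipticK k) 0 (PI / 2)) = 0).
  { rewrite Hg2. unfold Rdiv. ring. }
  replace (RInt (dellipticK k) 0 (PI / 2))
    with (/ (k * c2) * ellipticE k - / k * ellipticK k) by lra.
  change (/ (k * c2) * ellipticE k - / k * ellipticK k
    = (ellipticE k - c2 * ellipticK k) / (k * c2)).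
  field. lra.
Qed.

Lemma ellipticK_derive (k : R) : 0 < k < 1 ->
  is_derive ellipticK k ((ellipticE k - (1 - k ^ 2) * ellipticK k) / (k * (1 - k ^ 2))).
Proof.
  intros Hk. pose proof (pow2_lt_1 k Hk) as Hk2. pose proof (locally_pow2_lt_1 k Hk) as Hl.
  rewrite <- dellipticK_integral by assumption.
  assert (HD : forall u t, u ^ 2 < 1 ->
    Derive (fun z => 1 / sqrt (1 - z ^ 2 * sin t ^ 2)) u = dellipticK u t).
  { intros u t Hu. now apply is_derive_unique, ellipticK_integrand_derive. }
  rewrite <- (RInt_ext (fun t => Derive (fun z => 1 / sqrt (1 - z ^ 2 * sin t ^ 2)) k))
    by (intros; now apply HD).
  apply (is_derive_RInt_param (fun z t => 1 / sqrt (1 - z ^ 2 * sin t ^ 2)) 0 (PI / 2) k).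
  - apply filter_imp with (2 := Hl). intros u Hu t _.
    exists (dellipticK u t). now apply ellipticK_integrand_derive.
  - intros t _. apply continuity_2d_pt_ext_loc with dellipticK.
    + destruct Hl as [d Hd]. exists d. intros u v Hu _. symmetry. apply HD. now apply Hd.
    + now apply dellipticK_continuity_2d.
  - apply filter_imp with (2 := Hl). intros u Hu. apply ex_RInt_cont.
    intros t. now apply ellipticK_integrand_continuous.
Qed.

(** Pointwise, [(1 - k^2) / d < d] with [d^2 = 1 - k^2 sin^2]. *)
Lemma ellipticE_lower (k : R) : 0 < k < 1 -> (1 - k ^ 2) * ellipticK k < ellipticE k.
Proof.
  intros Hk. pose proof (pow2_lt_1 k Hk) as Hk2. pose proof PI_RGT_0.
  unfold ellipticK, ellipticE. rewrite <- RInt_scal_R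
    by (apply ex_RInt_cont; intros; now apply ellipticK_integrand_continuous).
  apply RInt_lt; [lra| | |].
  - intros; now apply ellipticE_integrand_continuous.
  - intros. apply (continuous_scal_r (K := R_AbsRing) (V := R_NormedModule) (1 - k ^ 2)
      (fun t => 1 / sqrt (1 - k ^ 2 * sin t ^ 2))).
    now apply ellipticK_integrand_continuous.
  - intros t Ht. pose proof (delta_pos k t Hk2) as Hd. pose proof (sqrt_lt_R0 _ Hd) as Hs.
    assert (Hc : 0 < cos t ^ 2) by (apply pow_lt, cos_gt_0; lra).
    rewrite cos2_sin2 in Hc.
    apply Rmult_lt_reg_r with (sqrt (1 - k ^ 2 * sin t ^ 2)); [assumption|].
    rewrite sqrt_sqrt by lra.
    replace ((1 - k ^ 2) * (1 / sqrt (1 - k ^ 2 * sin t ^ 2)) * sqrt (1 - k ^ 2 * sin t ^ 2))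
      with (1 - k ^ 2) by (field; lra).
    assert (0 < k ^ 2) by (apply pow_lt; lra). nra.
Qed.

(** * The sum of the series *)

(** The denominator of the closed form.  By Legendre's relation its value is [PI / 2]. *)
Definition legendre_form (k : R) : R :=
  ellipticK (compl_modulus k) * (ellipticE k - ellipticK k)
  + ellipticE (compl_modulus k) * ellipticK k.

(** Divided by [K K'], it is [E / K + E' / K' - 1 > (1 - k^2) + k^2 - 1 = 0]. *)
Lemma legendre_form_pos (k : R) : 0 < k < 1 -> 0 < legendre_form k.
Proof.
  intros Hk. pose proof (compl_bounds k Hk) as Hc.
  pose proof (ellipticE_lower k Hk). pose proof (ellipticE_lower _ Hc) as H1.
  pose proof (ellipticK_pos k (pow2_lt_1 k Hk)). pose proof (ellipticK_pos _ (pow2_lt_1 _ Hc)).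
  rewrite compl_sqr in H1 by (pose proof (pow2_lt_1 k Hk); lra).
  unfold legendre_form.
  set (K := ellipticK k) in *. set (K' := ellipticK (compl_modulus k)) in *.
  set (E := ellipticE k) in *. set (E' := ellipticE (compl_modulus k)) in *.
  assert (K' * ((1 - k ^ 2) * K) < K' * E) by (apply Rmult_lt_compat_l; lra).
  assert ((1 - (1 - k ^ 2)) * K' * K < E' * K) by (apply Rmult_lt_compat_r; lra).
  lra.
Qed.

Lemma compl_derive (k : R) : 0 < k < 1 ->
  is_derive compl_modulus k (- k / compl_modulus k).
Proof.
  intros Hk. pose proof (compl_bounds k Hk) as Hc. unfold compl_modulus in *.
  auto_derive.
  - pose proof (pow2_lt_1 k Hk). simpl in *. lra.
  - replace (1 + - (k * (k * 1))) with (1 - k ^ 2) by ring. field. lra.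
Qed.

Lemma nome_exponent_derive (k : R) : 0 < k < 1 ->
  is_derive nome_exponent k
    (- PI * legendre_form k / (ellipticK k ^ 2 * k * compl_modulus k ^ 2)).
Proof.
  intros Hk. pose proof (compl_bounds k Hk) as Hc.
  pose proof (pow2_lt_1 k Hk) as Hk2.
  pose proof (ellipticK_pos k Hk2) as HK.
  assert (Hc2 : compl_modulus k ^ 2 = 1 - k ^ 2) by (apply compl_sqr; lra).
  pose proof (ellipticK_derive k Hk) as HdK.
  set (c := compl_modulus k) in *.
  assert (HdK' : is_derive (fun x => ellipticK (compl_modulus x)) k
    ((- k / c) * ((ellipticE c - (1 - c ^ 2) * ellipticK c) / (c * (1 - c ^ 2)))))
    by exact (is_derive_comp ellipticK compl_modulus k _ _ (ellipticK_derive _ Hc)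
                (compl_derive k Hk)).
  eapply is_derive_value.
  - exact (is_derive_div (fun x => PI * ellipticK (compl_modulus x)) ellipticK k _ _
      (is_derive_scal _ k PI _ HdK') HdK ltac:(lra)).
  - unfold legendre_form. fold c.
    set (K := ellipticK k) in *. set (E := ellipticE k).
    set (K' := ellipticK c). set (E' := ellipticE c).
    replace (1 - c ^ 2) with (k ^ 2) by lra. rewrite <- Hc2.
    transitivity (- PI * (K' * (E - (c ^ 2 + k ^ 2) * K) + E' * K) / (K ^ 2 * k * c ^ 2)).
    + field. repeat split; lra.
    + rewrite Hc2. f_equal. ring.
Qed.

(** The chain rule solved for the series, in the radicals [p = sqrt (1 + k)],
    [m = sqrt (1 - k)], [c = k'] and [r = sqrt k'].  The terms in [E] agree at once; those
    in [K] agree by [- k * (p + m) = (1 + c) * (m - p)], a consequence of [c = p * m] and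
    [p^2 + m^2 = 2]. *)
Lemma closed_form_algebra (k c r p m K E W S dK : R) :
  0 < k -> 0 < c -> 0 < r -> 0 < p -> 0 < m -> 0 < K -> 0 < W ->
  p ^ 2 = 1 + k -> m ^ 2 = 1 - k -> c = p * m -> r ^ 2 = c ->
  dK = (E - c ^ 2 * K) / (k * c ^ 2) ->
  (- PI * W / (K ^ 2 * k * c ^ 2)) * (1 / 2 * S)
  = / PI * (dK * r * (p + m) + K * (- k / (2 * c * r)) * (p + m)
            + K * r * (1 / (2 * p) - 1 / (2 * m))) ->
  S = K ^ 2 * r * ((k * (m - p) + 2 * (m + p)) * K - 2 * (m + p) * E) / (PI ^ 2 * W).
Proof.
  intros Hk Hc Hr Hp Hm HK HW Hp2 Hm2 Hcpm Hrc HdK H.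
  pose proof PI_RGT_0 as HPI.
  set (X := dK * r * (p + m) + K * (- k / (2 * c * r)) * (p + m)
            + K * r * (1 / (2 * p) - 1 / (2 * m))) in *.
  assert (HX : k * c ^ 2 * X = - (r / 2) * ((k * (m - p) + 2 * (m + p)) * K - 2 * (m + p) * E)).
  { assert (H1 : k * c ^ 2 * X = (E - c ^ 2 * K) * r * (p + m) - K * k ^ 2 * (c / r) * (p + m) / 2
              + K * r * k * c * (c * (1 / p - 1 / m)) / 2).
    { unfold X. rewrite HdK. field. repeat split; lra. }
    assert (H2 : c / r = r) by (rewrite <- Hrc; field; lra).
    assert (H3 : c * (1 / p - 1 / m) = m - p) by (rewrite Hcpm; field; lra).
    rewrite H1, H2, H3.
    assert (Hkey : - (k * (p + m)) = (1 + c) * (m - p)).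
    { rewrite Hcpm. replace k with ((p ^ 2 - m ^ 2) / 2) by lra.
      replace 1 with ((p ^ 2 + m ^ 2) / 2) at 1 by lra. field. }
    assert (Hc2 : c ^ 2 = 1 - k ^ 2).
    { rewrite Hcpm. replace ((p * m) ^ 2) with (p ^ 2 * m ^ 2) by ring.
      rewrite Hp2, Hm2. ring. }
    rewrite Hc2.
    assert (Hk3 : - (k ^ 2 * (p + m)) = k * m - k * p + c * (k * m - k * p)).
    { transitivity (k * (- (k * (p + m)))); [ring|]. rewrite Hkey. ring. }
    apply Rminus_diag_uniq.
    transitivity (K * r / 2 * ((k ^ 2 * (p + m)) + (k * m - k * p + c * (k * m - k * p)))).
    - field.
    - rewrite <- Hk3. ring. }
  assert (HS : S = - 2 * (K ^ 2 * (k * c ^ 2 * X)) / (PI ^ 2 * W)).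
  { apply Rmult_eq_reg_l with (- PI * W / (K ^ 2 * k * c ^ 2) * (1 / 2)).
    - rewrite Rmult_assoc, H. field. repeat split; lra.
    - assert (0 < K ^ 2 * k * c ^ 2).
      { assert (0 < K ^ 2) by now apply pow_lt. assert (0 < c ^ 2) by now apply pow_lt.
        apply Rmult_lt_0_compat; [apply Rmult_lt_0_compat|]; assumption. }
      apply Rlt_not_eq.
      replace (- PI * W / (K ^ 2 * k * c ^ 2) * (1 / 2))
        with (- (PI * W / (K ^ 2 * k * c ^ 2) * (1 / 2))) by (field; repeat split; lra).
      apply Ropp_lt_gt_0_contravar. apply Rmult_lt_0_compat; [|lra].
      apply Rdiv_lt_0_compat; [nra|assumption]. }
  rewrite HS, HX. field. lra.
Qed.

Lemma closed_form_derive (k : R) : 0 < k < 1 ->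
  let c := compl_modulus k in let r := sqrt c in
  let p := sqrt (1 + k) in let m := sqrt (1 - k) in
  let K := ellipticK k in
  is_derive (fun x => ellipticK x / PI * sqrt (compl_modulus x) * (sqrt (1 + x) + sqrt (1 - x))) k
    (/ PI * ((ellipticE k - c ^ 2 * K) / (k * c ^ 2) * r * (p + m)
             + K * (- k / (2 * c * r)) * (p + m)
             + K * r * (1 / (2 * p) - 1 / (2 * m)))).
Proof.
  intros Hk c r p m K. pose proof PI_RGT_0 as HPI.
  pose proof (compl_bounds k Hk) as Hc. fold c in Hc.
  pose proof (sqrt_lt_R0 c (proj1 Hc)) as Hr. fold r in Hr.
  pose proof (sqrt_lt_R0 (1 + k) ltac:(lra)) as Hp. fold p in Hp.
  pose proof (sqrt_lt_R0 (1 - k) ltac:(lra)) as Hm. fold m in Hm.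
  assert (Hc2 : c ^ 2 = 1 - k ^ 2) by (apply compl_sqr; pose proof (pow2_lt_1 k Hk); lra).
  pose proof (ellipticK_derive k Hk) as HdK. rewrite <- Hc2 in HdK. fold K in HdK.
  assert (Hsc : is_derive (fun x => sqrt (compl_modulus x)) k ((- k / c) * (/ (2 * r)))).
  { apply (is_derive_comp sqrt compl_modulus k).
    - apply is_derive_Reals, derivable_pt_lim_sqrt, Hc.
    - now apply compl_derive. }
  assert (Hpm : is_derive (fun x => sqrt (1 + x) + sqrt (1 - x)) k (1 / (2 * p) - 1 / (2 * m))).
  { auto_derive; [repeat split; lra|].
    replace (1 + - k) with (1 - k) by ring. fold p m. field. lra. }
  assert (HK : is_derive (fun x => / PI * ellipticK x) k
     (/ PI * ((ellipticE k - c ^ 2 * K) / (k * c ^ 2)))).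
  { exact (is_derive_scal ellipticK k (/ PI) _ HdK). }
  apply is_derive_ext with
    (fun x => / PI * ellipticK x * sqrt (compl_modulus x) * (sqrt (1 + x) + sqrt (1 - x))).
  { intros x. match goal with |- ?a = ?b => change (@eq R a b) end. unfold Rdiv. ring. }
  pose proof (is_derive_mult (K := R_AbsRing) _ _ k _ _ HK Hsc Rmult_comm) as H1.
  pose proof (is_derive_mult (K := R_AbsRing) _ _ k _ _ H1 Hpm Rmult_comm) as H2.
  eapply is_derive_value; [exact H2|].
  change (((/ PI * ((ellipticE k - c ^ 2 * K) / (k * c ^ 2))) * r
     + (/ PI * K) * ((- k / c) * (/ (2 * r)))) * (p + m)
     + ((/ PI * K) * r) * (1 / (2 * p) - 1 / (2 * m)) =
    / PI * ((ellipticE k - c ^ 2 * K) / (k * c ^ 2) * r * (p + m)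
             + K * (- k / (2 * c * r)) * (p + m)
             + K * r * (1 / (2 * p) - 1 / (2 * m)))).
  field. repeat split; lra.
Qed.

Lemma sech2_sum_pos_modulus (k : R) : 0 < k < 1 ->
  Series (sech2_term k) =
    (ellipticK k ^ 2 * sqrt (compl_modulus k)
     * ((k * (sqrt (1 - k) - sqrt (1 + k))
         + 2 * (sqrt (1 - k) + sqrt (1 + k))) * ellipticK k
        - 2 * (sqrt (1 - k) + sqrt (1 + k)) * ellipticE k))
    / (PI ^ 2 * legendre_form k).
Proof.
  intros Hk. pose proof (compl_bounds k Hk) as Hc. pose proof (pow2_lt_1 k Hk) as Hk2.
  pose proof (ellipticK_pos k Hk2) as HK.
  pose proof (nome_exponent_pos k Hk) as Hh.
  pose proof (is_derive_comp (fun y => sumV (2 * y)) nome_exponent k _ _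
    (sumV_derive _ Hh) (nome_exponent_derive k Hk)) as H1.
  assert (H2 : is_derive (fun x => sumV (2 * nome_exponent x)) k
    (/ PI * ((ellipticE k - compl_modulus k ^ 2 * ellipticK k) / (k * compl_modulus k ^ 2)
        * sqrt (compl_modulus k) * (sqrt (1 + k) + sqrt (1 - k))
      + ellipticK k * (- k / (2 * compl_modulus k * sqrt (compl_modulus k)))
        * (sqrt (1 + k) + sqrt (1 - k))
      + ellipticK k * sqrt (compl_modulus k)
        * (1 / (2 * sqrt (1 + k)) - 1 / (2 * sqrt (1 - k)))))).
  { apply is_derive_ext_loc with (2 := closed_form_derive k Hk).
    apply filter_imp with (fun x => 0 < x /\ x < 1).
    - intros x Hx. symmetry. now apply sumV_elliptic.
    - apply (open_and (fun u => 0 < u) (fun u => u < 1)); [apply open_gt|apply open_lt|exact Hk]. }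
  apply is_derive_unique in H1. apply is_derive_unique in H2. rewrite H1 in H2. clear H1.
  rewrite (Series_ext (sech2_term k) (fun n => chi n * (2 * INR n + 1)
    * sech ((2 * INR n + 1) * nome_exponent k / 2) ^ 2)).
  - apply closed_form_algebra with (c := compl_modulus k)
      (dK := (ellipticE k - compl_modulus k ^ 2 * ellipticK k) / (k * compl_modulus k ^ 2));
      try lra; try (apply sqrt_lt_R0; lra).
    + now apply legendre_form_pos.
    + apply pow2_sqrt; lra.
    + apply pow2_sqrt; lra.
    + rewrite <- sqrt_mult by lra. unfold compl_modulus. f_equal. ring.
    + apply pow2_sqrt; lra.
    + exact H2.
  - intros n. unfold sech2_term, nome_exponent, chi. do 3 f_equal. field. lra.
Qed.

Theorem mainTheorem10 :
  forall k : R, 0 < k ^ 2 < 1 ->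
  ex_series (sech2_term k) ->
  let k' := compl_modulus k in
  let K := ellipticK k in
  let E := ellipticE k in
  let K' := ellipticK k' in
  let E' := ellipticE k' in
  Series (sech2_term k) =
    (K ^ 2 * sqrt k'
     * ((k * (sqrt (1 - k) - sqrt (1 + k))
         + 2 * (sqrt (1 - k) + sqrt (1 + k))) * K
        - 2 * (sqrt (1 - k) + sqrt (1 + k)) * E))
    / (PI ^ 2 * (K' * (E - K) + E' * K)).
Proof.
  intros k Hk _. cbv zeta.
  (* Both sides are even in the modulus. *)
  destruct (Rle_dec 0 k) as [H0|H0].
  - assert (Hk1 : 0 < k < 1) by nra. exact (sech2_sum_pos_modulus k Hk1).
  - assert (Hk1 : 0 < - k < 1) by nra.
    pose proof (sech2_sum_pos_modulus (- k) Hk1) as H.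
    assert (Hsq : (- k) ^ 2 = k ^ 2) by ring.
    assert (HK : ellipticK (- k) = ellipticK k) by (unfold ellipticK; now rewrite Hsq).
    assert (HE : ellipticE (- k) = ellipticE k) by (unfold ellipticE; now rewrite Hsq).
    assert (Hc : compl_modulus (- k) = compl_modulus k) by (unfold compl_modulus; now rewrite Hsq).
    rewrite (Series_ext (sech2_term (- k)) (sech2_term k)) in H
      by (intros n; unfold sech2_term; now rewrite HK, Hc).
    rewrite H. unfold legendre_form. rewrite HK, HE, Hc.
    replace (1 - - k) with (1 + k) by ring. replace (1 + - k) with (1 - k) by ring.
    f_equal. ring.
Qed.
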